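(* Let $3\le k\le\frac N2$ and $G=\mathrm{Gr}(k,\mathbb C^N)$. For $2\le l\le k$, the distance-$l$ tangent orbit $\Theta_{l,G}$ has dimension $$\dim\Theta_{l,G}=\begin{cases}k(N-k)+2(N-2)-3&\text{for }l=2,\\ k(N-k)+l(N-l)&\text{for }l\ge3.\end{cases}$$
   Context: $G=\mathrm{Gr}(k,\mathbb C^N)\subset\mathbb P(\bigwedge^k\mathbb C^N)$ is the Grassmannian in its Plücker embedding; $p=[v_1\wedge\dots\wedge v_k]$ corresponds to $H_p=\langle v_1,\dots,v_k\rangle$. The affine tangent space to $G$ at $p$ is $\hat T_pG=\bigwedge^{k-1}H_p\wedge\mathbb C^N$, and $\hat T_pG/\langle p\rangle\simeq\mathrm{Hom}(H_p,\mathbb C^N/H_p)$. For $1\le l\le k$, $\Theta_{l,G}\subset\mathbb P(\bigwedge^k\mathbb C^N)$ is the set of points $[t]$ such that, for some $p\in G$, $t\in\hat T_pG$ and the image of $t$ in $\mathrm{Hom}(H_p,\mathbb C^N/H_p)$ has rank $l$ (it is an $\mathrm{SL}(N)$-orbit). The dimension is that of a locally closed subvariety of projective space. *)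

(* Defs.v *)
From HB Require Import structures.
From mathcomp Require Import all_boot all_order all_algebra.
From mathcomp Require Import classical_sets reals.
From mathcomp Require Import complex.
From mathcomp Require Import mpoly.

Set Implicit Arguments.
Unset Strict Implicit.
Unset Printing Implicit Defensive.

Import GRing.Theory.

Local Open Scope ring_scope.
Local Open Scope classical_set_scope.

Section Projective.
Variables (F : fieldType) (m : nat).

(* A point of P(F^m) is a line of F^m; the point [t] is the x with
   val x = <[t]>%VS, which forces t != 0. *)
Definition projective_space :=
  {L : {vspace 'rV[F]_m} | \dim L == 1%N}.

Definition zero_locus (S : set {mpoly F[m]}) : set projective_space :=
  [set x : projective_space | forall (f : {mpoly F[m]}) (t : 'rV[F]_m),
     S f -> t \in val x -> f.@[fun i => t 0 i] = 0].

Definition zariski_closed (Z : set projective_space) : Prop :=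
  exists S : set {mpoly F[m]},
    (forall f, S f -> exists d : nat, f \is d.-homog) /\ Z = zero_locus S.

Definition zariski_closed_in (X A : set projective_space) : Prop :=
  exists2 Z, zariski_closed Z & A = X `&` Z.

Definition zariski_irreducible (A : set projective_space) : Prop :=
  A !=set0 /\
  forall Z1 Z2, zariski_closed Z1 -> zariski_closed Z2 ->
    A `<=` Z1 `|` Z2 -> A `<=` Z1 \/ A `<=` Z2.

(* Z 0, ..., Z d: d strict inclusions; the values Z i for d < i are junk. *)
Definition irreducible_chain (X : set projective_space) (d : nat)
    (Z : nat -> set projective_space) : Prop :=
  (forall i, (i <= d)%N -> zariski_closed_in X (Z i) /\ zariski_irreducible (Z i))
  /\ (forall i, (i < d)%N -> Z i `<` Z i.+1).

(* Krull dimension of X for the topology induced by the Zariski topology. *)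
Definition has_dimension (X : set projective_space) (d : nat) : Prop :=
  (exists Z, irreducible_chain X d Z) /\
  (forall e Z, irreducible_chain X e Z -> (e <= d)%N).

End Projective.

(* Increasing maps 'I_k -> 'I_N index the standard basis
   e_(f 0) /\ ... /\ e_(f (k-1)) of the k-th exterior power of F^N. *)
Definition wedge_index (k N : nat) :=
  {f : {ffun 'I_k -> 'I_N} |
    [forall i : 'I_k, forall j : 'I_k, (i < j)%N ==> (f i < f j)%N]}.

Definition extdim (k N : nat) : nat := #|{: wedge_index k N}|.

Section Grassmannian.
Variables (F : fieldType) (k N : nat).

(* The k-th exterior power of F^N, in coordinates. *)
Local Notation extpow := 'rV[F]_(extdim k N).

(* w_1 /\ ... /\ w_k, where the w_i are the rows of W: its coordinates in the
   standard basis are the maximal minors of W. *)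
Definition wedge (W : 'M[F]_(k, N)) : extpow :=
  \row_(i < extdim k N) \det (colsub (val (enum_val i)) W).

(* The rows of V form a basis of H_p, and p = [v_1 /\ ... /\ v_k]. *)
Definition plucker_basis
    (p : projective_space F (extdim k N)) (V : 'M[F]_(k, N)) : Prop :=
  row_free V /\ val p = <[wedge V]>%VS.

Definition grassmannian : set (projective_space F (extdim k N)) :=
  [set p | exists V, plucker_basis p V].

(* \bigwedge^(k-1) H /\ F^N for H the row space of V: sums of decomposable
   elements whose first k-1 factors lie in H (scalars are absorbed by the last
   factor). *)
Definition affine_tangent_space (V : 'M[F]_(k, N)) : set extpow :=
  [set t | exists n (W : 'I_n -> 'M[F]_(k, N)),
     (forall (a : 'I_n) (j : 'I_k), (j.+1 < k)%N -> (row j (W a) <= V)%MS) /\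
     t = \sum_(a < n) wedge (W a)].

Definition replace_row (V Phi : 'M[F]_(k, N)) (i : 'I_k) : 'M[F]_(k, N) :=
  \matrix_(a, b) (if a == i then Phi a b else V a b).

(* A matrix Phi represents the map phi : H -> F^N / H sending v_i to the class
   of the i-th row of Phi.  Under T^/<p> = Hom(H, F^N / H), phi corresponds to
   the class modulo v_1 /\ ... /\ v_k of
     \sum_i v_1 /\ ... /\ phi(v_i) /\ ... /\ v_k. *)
Definition tangent_image (V : 'M[F]_(k, N)) (t : extpow) (Phi : 'M[F]_(k, N))
    : Prop :=
  exists c : F, t = c *: wedge V + \sum_(i < k) wedge (replace_row V Phi i).

(* cokermx V, acting on row vectors, has kernel the row space H of V, so it
   realises the projection F^N -> F^N / H. *)
Definition hom_rank (V Phi : 'M[F]_(k, N)) : nat := \rank (Phi *m cokermx V).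

Definition tangent_orbit (l : nat)
    : set (projective_space F (extdim k N)) :=
  [set x | exists p (V : 'M[F]_(k, N)) (t : extpow) (Phi : 'M[F]_(k, N)),
     [/\ grassmannian p, plucker_basis p V & val x = <[t]>%VS] /\
     [/\ affine_tangent_space V t, tangent_image V t Phi & hom_rank V Phi = l]].

End Grassmannian.

Arguments tangent_orbit : clear implicits.
Arguments grassmannian : clear implicits.

(* Main.v *)
Require Import Defs.
From mathcomp Require Import all_boot all_order all_algebra.
From mathcomp Require Import classical_sets reals.
From mathcomp Require Import complex.
From mathcomp Require Import all_fingroup boolp mpoly ring zify.

(** The affine cone over the orbit consists of the vectors
    t = c w_0 + w_1, where w_0 + u w_1 + u^2 w_2 + ... = wedge (V + u Phi) and
    Phi has rank l modulo the rows of V.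

    Upper bound.  A strict chain Z_0 < ... < Z_e gives e + 1 forms that are
    algebraically independent on the cone of Z_e: a form vanishing on Z_i but not on
    Z_(i+1) is transcendental over the forms found so far.  On the other hand the
    cone of the orbit lies in the Zariski closure of the image of a polynomial map
    with d + 1 parameters, so that any d + 2 forms are dependent on it.  For l >= 3
    the parameters are c, the free entries A of V = [1 | A], and those of
    Phi = [0 | [1; D] M].  For l = 2, replacing V by V + Phi / c turns t into
    c w_0 - w_2 / c, and w_2 depends only on the second exterior power of Phi: this
    is where three parameters are lost.

    Lower bound.  The closures of the images of a flag of coordinate subspaces form
    a chain, provided that at each step some form detects the freed coordinate.
    Taking c = 1, V = [1 | A - B] and Phi = [0 | B], the coordinates of t are
    A_ij in degree 1 and, for A = 0, a nonzero multiple of each r x r minor of B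
    with r <> 1.  With B = [1; D] adj(K) [1 | E], the l x l minors detect D and E,
    and the (l-1) x (l-1) minors detect K when l >= 3. *)

Set Implicit Arguments.
Unset Strict Implicit.
Unset Printing Implicit Defensive.

Import GRing.Theory Num.Theory.

Local Open Scope ring_scope.

(** * Polynomial functions and counting of monomials *)

Section PolynomialFunctions.
Variable F : comNzRingType.

(** The algebra of functions generated by [G], on an arbitrary domain. Closure under determinants
    and adjugates avoids writing polynomials down; a genuine polynomial is extracted only where
    roots or monomials are counted. *)
Inductive polyfun (T : Type) (G : (T -> F) -> Prop) : (T -> F) -> Prop :=
| polyfun_gen f : G f -> polyfun G f
| polyfun_const c : polyfun G (fun _ => c)
| polyfun_add f g : polyfun G f -> polyfun G g -> polyfun G (fun t => f t + g t)
| polyfun_mul f g : polyfun G f -> polyfun G g -> polyfun G (fun t => f t * g t).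

Definition coordinate (J : Type) (f : (J -> F) -> F) : Prop :=
  exists j, f = fun p => p j.

Section Closure.
Variables (T : Type) (G : (T -> F) -> Prop).
Local Notation pf := (polyfun G).

Lemma polyfun_ext f g : f =1 g -> pf f -> pf g.
Proof. by move=> /funext ->. Qed.

Lemma polyfun_opp f : pf f -> pf (fun t => - f t).
Proof.
move=> pff; apply: (@polyfun_ext (fun t => -1 * f t)) => [t|].
  by rewrite mulN1r.
by apply: polyfun_mul => //; apply: polyfun_const.
Qed.

Lemma polyfun_sub f g : pf f -> pf g -> pf (fun t => f t - g t).
Proof. by move=> pff pfg; apply: polyfun_add => //; apply: polyfun_opp. Qed.

Lemma polyfun_sum (I : Type) (s : seq I) (P : pred I) (f : I -> T -> F) :
  (forall i, pf (f i)) -> pf (fun t => \sum_(i <- s | P i) f i t).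
Proof.
move=> pff; elim: s => [|i s IHs].
  apply: (@polyfun_ext (fun=> 0)) => [t|]; first by rewrite big_nil.
  exact: polyfun_const.
apply: (@polyfun_ext (fun t => (if P i then f i t else 0)
                               + \sum_(i <- s | P i) f i t)) => [t|].
  by rewrite big_cons; case: (P i); rewrite ?add0r.
apply: polyfun_add => //; case: (P i) => //; exact: polyfun_const.
Qed.

Lemma polyfun_prod (I : Type) (s : seq I) (P : pred I) (f : I -> T -> F) :
  (forall i, pf (f i)) -> pf (fun t => \prod_(i <- s | P i) f i t).
Proof.
move=> pff; elim: s => [|i s IHs].
  apply: (@polyfun_ext (fun=> 1)) => [t|]; first by rewrite big_nil.
  exact: polyfun_const.
apply: (@polyfun_ext (fun t => (if P i then f i t else 1)
                               * \prod_(i <- s | P i) f i t)) => [t|].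
  by rewrite big_cons; case: (P i); rewrite ?mul1r.
apply: polyfun_mul => //; case: (P i) => //; exact: polyfun_const.
Qed.

Lemma polyfun_exp f n : pf f -> pf (fun t => f t ^+ n).
Proof.
move=> pff; elim: n => [|n IHn]; first exact: polyfun_const.
apply: (@polyfun_ext (fun t => f t * f t ^+ n)) => [t|]; first by rewrite exprS.
exact: polyfun_mul.
Qed.

Lemma polyfun_meval m (q : {mpoly F[m]}) (v : T -> 'I_m -> F) :
  (forall i, pf (fun t => v t i)) -> pf (fun t => q.@[v t]).
Proof.
move=> pfv.
apply: (@polyfun_ext (fun t => \sum_(m <- msupp q) q@_m * \prod_i v t i ^+ m i)).
  by move=> t; rewrite mevalE.
apply: polyfun_sum => a; apply: polyfun_mul; first exact: polyfun_const.
by apply: polyfun_prod => i; apply: polyfun_exp.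
Qed.

Definition polyfun_mx a b (A : T -> 'M[F]_(a, b)) : Prop :=
  forall i j, pf (fun t => A t i j).

Lemma polyfun_mx_const a b (A : 'M[F]_(a, b)) : polyfun_mx (fun=> A).
Proof. by move=> i j; apply: polyfun_const. Qed.

Lemma polyfun_mx_add a b (A B : T -> 'M[F]_(a, b)) :
  polyfun_mx A -> polyfun_mx B -> polyfun_mx (fun t => A t + B t).
Proof.
move=> pfA pfB i j; apply: (@polyfun_ext (fun t => A t i j + B t i j)).
  by move=> t; rewrite mxE.
exact: polyfun_add.
Qed.

Lemma polyfun_mx_opp a b (A : T -> 'M[F]_(a, b)) :
  polyfun_mx A -> polyfun_mx (fun t => - A t).
Proof.
move=> pfA i j; apply: (@polyfun_ext (fun t => - A t i j)).
  by move=> t; rewrite mxE.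
exact: polyfun_opp.
Qed.

Lemma polyfun_mx_scale a b (c : T -> F) (A : T -> 'M[F]_(a, b)) :
  pf c -> polyfun_mx A -> polyfun_mx (fun t => c t *: A t).
Proof.
move=> pfc pfA i j; apply: (@polyfun_ext (fun t => c t * A t i j)).
  by move=> t; rewrite mxE.
exact: polyfun_mul.
Qed.

Lemma polyfun_mx_mul a b c (A : T -> 'M[F]_(a, b)) (B : T -> 'M[F]_(b, c)) :
  polyfun_mx A -> polyfun_mx B -> polyfun_mx (fun t => A t *m B t).
Proof.
move=> pfA pfB i j.
apply: (@polyfun_ext (fun t => \sum_k A t i k * B t k j)).
  by move=> t; rewrite mxE.
by apply: polyfun_sum => k; apply: polyfun_mul.
Qed.

Lemma polyfun_mx_row a b1 b2 (A : T -> 'M[F]_(a, b1)) (B : T -> 'M[F]_(a, b2)) :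
  polyfun_mx A -> polyfun_mx B -> polyfun_mx (fun t => row_mx (A t) (B t)).
Proof.
move=> pfA pfB i j; case: (split_ordP j) => [j' -> | j' ->].
  by apply: (@polyfun_ext (fun t => A t i j')) => [t|]; rewrite ?row_mxEl.
by apply: (@polyfun_ext (fun t => B t i j')) => [t|]; rewrite ?row_mxEr.
Qed.

Lemma polyfun_mx_col a1 a2 b (A : T -> 'M[F]_(a1, b)) (B : T -> 'M[F]_(a2, b)) :
  polyfun_mx A -> polyfun_mx B -> polyfun_mx (fun t => col_mx (A t) (B t)).
Proof.
move=> pfA pfB i j; case: (split_ordP i) => [i' -> | i' ->].
  by apply: (@polyfun_ext (fun t => A t i' j)) => [t|]; rewrite ?col_mxEu.
by apply: (@polyfun_ext (fun t => B t i' j)) => [t|]; rewrite ?col_mxEd.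
Qed.

Lemma polyfun_mx_sub a b a' b' (f : 'I_a' -> 'I_a) (g : 'I_b' -> 'I_b)
    (A : T -> 'M[F]_(a, b)) :
  polyfun_mx A -> polyfun_mx (fun t => mxsub f g (A t)).
Proof.
move=> pfA i j; apply: (@polyfun_ext (fun t => A t (f i) (g j))) => [t|//].
by rewrite mxE.
Qed.

Lemma polyfun_det n (A : T -> 'M[F]_n) : polyfun_mx A -> pf (fun t => \det (A t)).
Proof.
move=> pfA; apply: polyfun_sum => s; apply: polyfun_mul.
  exact: polyfun_const.
by apply: polyfun_prod => i.
Qed.

Lemma polyfun_adj n (A : T -> 'M[F]_n) :
  polyfun_mx A -> polyfun_mx (fun t => \adj (A t)).
Proof.
move=> pfA i j.
apply: (@polyfun_ext (fun t => cofactor (A t) j i)) => [t|]; first by rewrite mxE.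
apply: polyfun_mul; first exact: polyfun_const.
apply: polyfun_det => i' j'.
apply: (@polyfun_ext (fun t => A t (lift j i') (lift i j'))) => [t|//].
by rewrite !mxE.
Qed.

End Closure.

Lemma polyfun_comp T T' (G : (T -> F) -> Prop) (G' : (T' -> F) -> Prop) h f :
  (forall g, G g -> polyfun G' (g \o h)) -> polyfun G f -> polyfun G' (f \o h).
Proof.
move=> hG; elim=> {f} [f /hG //|c|f g _ hf _ hg|f g _ hf _ hg].
- exact: polyfun_const.
- exact: (polyfun_add hf hg).
- exact: (polyfun_mul hf hg).
Qed.

Lemma polyfun_poly f : polyfun (eq id) f -> exists p : {poly F}, forall u, f u = p.[u].
Proof.
elim=> {f} [f <-|c|f g _ [p hp] _ [q hq]|f g _ [p hp] _ [q hq]].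
- by exists 'X => u; rewrite hornerX.
- by exists c%:P => u; rewrite hornerC.
- by exists (p + q) => u; rewrite hornerD hp hq.
- by exists (p * q) => u; rewrite hornerM hp hq.
Qed.

Lemma polyfun_mpoly (J : finType) f : polyfun (@coordinate J) f ->
  exists q : {mpoly F[#|J|]}, forall p, f p = q.@[fun i => p (enum_val i)].
Proof.
elim=> {f} [f [j ->]|c|f g _ [p hp] _ [q hq]|f g _ [p hp] _ [q hq]].
- by exists 'X_(enum_rank j) => u; rewrite mevalXU enum_rankK.
- by exists c%:MP => u; rewrite mevalC.
- by exists (p + q) => u; rewrite mevalD hp hq.
- by exists (p * q) => u; rewrite mevalM hp hq.
Qed.

Lemma polyfun_line (J : Type) f (a b : J -> F) : polyfun (@coordinate J) f ->
  polyfun (eq id) (fun u => f (fun j => a j + u * (b j - a j))).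
Proof.
apply: (polyfun_comp (h := fun u j => a j + u * (b j - a j))) => _ [j ->].
apply: polyfun_add; first exact: polyfun_const.
by apply: polyfun_mul; [exact: polyfun_gen | exact: polyfun_const].
Qed.

End PolynomialFunctions.

(** * Zero tests for polynomial functions of one variable *)

Section ZeroPrinciple.
Variable F : numDomainType.

Lemma poly_eq0_horner (p : {poly F}) : (forall u, p.[u] = 0) -> p = 0.
Proof.
move=> p0; apply/eqP/negPn/negP => nz_p.
pose s : seq F := [seq n%:R | n <- iota 0 (size p)].
have: (size s < size p)%N.
  apply: max_poly_roots => //; first by apply/allP => x _; apply/rootP.
  by rewrite map_inj_uniq ?iota_uniq // => i j /eqP; rewrite eqr_nat => /eqP.
by rewrite size_map size_iota ltnn.
Qed.

(** The product vanishes identically and polynomials over [F] form a domain. A nonempty open part of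
    the line is thus dense. *)
Lemma polyfun_zero_off f g : polyfun (eq id) f -> polyfun (eq id) g ->
  (exists u : F, g u != 0) -> (forall u, g u != 0 -> f u = 0) ->
  forall u, f u = 0.
Proof.
move=> /polyfun_poly[p hp] /polyfun_poly[q hq] [u0 gu0] fg u.
have pq0 : p * q = 0.
  apply: poly_eq0_horner => v; rewrite hornerM -hp -hq.
  by have [-> | /fg ->] := eqVneq (g v) 0; rewrite ?mulr0 ?mul0r.
have /eqP := pq0; rewrite mulf_eq0 => /orP[] /eqP e0.
  by rewrite hp e0 horner0.
by rewrite hq e0 horner0 eqxx in gu0.
Qed.

Lemma polyfun_mul_neq0 f g : polyfun (eq id) f -> polyfun (eq id) g ->
  (exists u : F, f u != 0) -> (exists u, g u != 0) -> exists u, f u * g u != 0.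
Proof.
move=> pff pfg [u fu] nz_g; apply: contrapT => none; case/eqP: fu.
apply: (polyfun_zero_off pff pfg nz_g) => v gv; apply/eqP/negPn/negP => fv.
by apply: none; exists v; rewrite mulf_neq0.
Qed.

End ZeroPrinciple.

Section Monomials.
Variables (F : fieldType) (m : nat).

(* The exponents are the digits of i in base M, the head of y getting the
   leading digit. *)
Fixpoint monomial (M : nat) (y : seq {mpoly F[m]}) (i : nat) : {mpoly F[m]} :=
  if y is f :: y' then f ^+ (i %/ M ^ size y') * monomial M y' (i %% M ^ size y')
  else 1.

Lemma sum_nat_mul (V : nmodType) K B (G : nat -> V) :
  \sum_(0 <= i < B * K) G i = \sum_(0 <= b < B) \sum_(0 <= i < K) G (b * K + i)%N.
Proof.
elim: B => [|B IHB]; first by rewrite mul0n !big_geq.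
rewrite big_nat_recr //= -IHB (big_cat_nat (n := (B * K)%N)) ?leq_mul //=.
congr (_ + _); rewrite -{1}[(B * K)%N]add0n big_addn mulSn addnK.
by apply: eq_bigr => i _; rewrite addnC.
Qed.

Lemma monomial_cons M f y b i : (i < M ^ size y)%N ->
  monomial M (f :: y) (b * M ^ size y + i) = f ^+ b * monomial M y i.
Proof.
move=> lti; have K0 : (0 < M ^ size y)%N by apply: leq_ltn_trans lti.
by rewrite /= divnMDl // divn_small // addn0 modnMDl modn_small.
Qed.

Lemma msize_mul_le (f g : {mpoly F[m]}) a b :
  (msize f <= a.+1 -> msize g <= b.+1 -> msize (f * g) <= (a + b).+1)%N.
Proof.
move=> hf hg; have [->|nz_f] := eqVneq f 0; first by rewrite mul0r msize0.
have [->|nz_g] := eqVneq g 0; first by rewrite mulr0 msize0.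
rewrite msizeM //; move: (msize f) (msize g) hf hg => u v; lia.
Qed.

Lemma msize_exp (f : {mpoly F[m]}) d b :
  (msize f <= d.+1)%N -> (msize (f ^+ b) <= (b * d).+1)%N.
Proof.
move=> hf; elim: b => [|b IHb]; first by rewrite expr0 msize1.
by rewrite exprS mulSn; apply: msize_mul_le.
Qed.

Lemma msize_monomial M y d i : {in y, forall f, (msize f <= d.+1)%N} ->
  (i < M ^ size y)%N -> (msize (monomial M y i) <= (size y * (M * d)).+1)%N.
Proof.
elim: y i => [|f y IHy] i hy lti; first by rewrite /= msize1.
have K0 : (0 < M ^ size y)%N.
  by rewrite expn_gt0; move: lti; rewrite /= expnS; case: (M).
have hb : (i %/ M ^ size y < M)%N by rewrite ltn_divLR // -expnS.
rewrite /= mulSn; apply: msize_mul_le; last first.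
  by apply: IHy (ltn_pmod _ K0) => g gy; apply: hy; rewrite inE gy orbT.
apply: leq_trans (msize_exp _ (hy f (mem_head _ _))) _.
by rewrite ltnS leq_mul2r ltnW ?orbT.
Qed.

(* There are too few monomials of bounded degree in m variables. *)
Lemma monomial_dependent (y : seq {mpoly F[m]}) : (m < size y)%N ->
  exists M (c : nat -> F), (exists2 i, (i < M ^ size y)%N & c i != 0) /\
    \sum_(0 <= i < M ^ size y) c i *: monomial M y i = 0.
Proof.
move=> lt_m_y; pose d := \max_(f <- y) msize f.
have hd : {in y, forall f, (msize f <= d.+1)%N}.
  by move=> f fy; apply/leqW; rewrite /d (big_rem f) //= leq_maxl.
(* Each of the [M ^ s] monomials has degree below [D = a * M], while only [D ^ m = a ^ m * M ^ m < M
   ^ m.+1 <= M ^ s] exponent vectors have all entries below [D]. *)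
pose s := size y; pose a := (s * d).+1; pose M := (a ^ m).+1.
pose D := (a * M)%N; pose T := {ffun 'I_m -> 'I_D}.
have hM i : (i < M ^ s)%N -> (msize (monomial M y i) <= D)%N.
  by move=> /(msize_monomial hd) /leq_trans -> //; rewrite /D /a mulSn -/s; nia.
pose mon (b : T) := [multinom val (b j) | j < m].
pose A := \matrix_(i < M ^ s, j < #|{: T}|) (monomial M y i)@_(mon (enum_val j)).
have ltTM : (#|{: T}| < M ^ s)%N.
  rewrite card_ffun !card_ord /D expnMn.
  apply: (@leq_trans (M ^ m.+1)); last by rewrite leq_pexp2l.
  by rewrite expnS ltn_pmul2r ?expn_gt0.
have /rowV0Pn[u] : kermx A != 0.
  by rewrite -mxrank_eq0 mxrank_ker -lt0n subn_gt0 (leq_ltn_trans (rank_leq_col _)).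
move=> /sub_kermxP uA0 nz_u.
pose c i := if insub i is Some j then u 0 j else 0.
have cE (j : 'I_(M ^ s)) : c j = u 0 j by rewrite /c valK.
exists M, c; split.
  by have [j nz_uj] := rV0Pn _ nz_u; exists j; rewrite ?cE.
rewrite big_mkord; apply/mpolyP => e; rewrite raddf_sum /= mcoeff0.
have [lt_eD|le_De] := ltnP (mdeg e) D; last first.
  apply: big1 => i _; rewrite mcoeffZ memN_msupp_eq0 ?mulr0 //.
  by apply: msize_mdeg_ge; apply: leq_trans le_De; apply: hM.
have lt_ej j : (e j < D)%N.
  by apply: leq_ltn_trans lt_eD; rewrite mdegE (bigD1 j) //= leq_addr.
pose b : T := [ffun j => Ordinal (lt_ej j)].
have monb : mon b = e by apply/mnmP => j; rewrite mnmE ffunE.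
have /matrixP /(_ 0 (enum_rank b)) := uA0; rewrite !mxE => uAb.
by rewrite -[RHS]uAb; apply: eq_bigr => i _; rewrite mcoeffZ cE !mxE enum_rankK monb.
Qed.

End Monomials.

(** * Cones and chains *)

Section Cones.
Variables (F : numFieldType) (m : nat).
Local Open Scope classical_set_scope.
Local Notation proj := (projective_space F m).
Local Notation "f .[! t ]" := (f.@[fun i => t 0 i]) (at level 2, format "f .[! t ]").

Lemma projective_pointP (t : 'rV[F]_m) : t != 0 -> exists x : proj, val x = <[t]>%VS.
Proof.
move=> nz_t; have dt : \dim <[t]>%VS == 1%N by rewrite dim_vline nz_t.
by exists (exist _ <[t]>%VS dt).
Qed.

Lemma projective_generator (x : proj) : exists2 t, t != 0 & val x = <[t]>%VS.
Proof.
case: x => L /= dL; exists (vpick L).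
  by rewrite vpick0 -dimv_eq0 (eqP dL).
apply/eqP; rewrite eq_sym eqEdim (eqP dL) -memvE memv_pick dim_vline.
by rewrite vpick0 -dimv_eq0 (eqP dL).
Qed.

Lemma meval_homog (f : {mpoly F[m]}) d a (t : 'rV[F]_m) :
  f \is d.-homog -> f.[! a *: t] = a ^+ d * f.[! t].
Proof.
move=> /dhomogP hf; rewrite !mevalE mulr_sumr; apply: eq_big_seq => e /hf <-.
rewrite mulrCA; congr (_ * _); rewrite /= mdegE -prodrXr -big_split /=.
by apply: eq_bigr => i _; rewrite mxE exprMn.
Qed.

Definition cone (A : set proj) : set 'rV[F]_m :=
  [set t | exists2 x, A x & t \in val x].

Lemma cone_scale A a t : cone A t -> cone A (a *: t).
Proof. by case=> x Ax xt; exists x => //; apply: memvZ. Qed.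

Lemma cone0 (A : set proj) : A !=set0 -> cone A 0.
Proof. by case=> x Ax; exists x => //; apply: mem0v. Qed.

Lemma meval_homog_point (f : {mpoly F[m]}) d (x : proj) t : f \is d.-homog ->
  val x = <[t]>%VS -> f.[! t] = 0 -> forall s, s \in val x -> f.[! s] = 0.
Proof.
by move=> hf -> ft s /vlineP[a ->]; rewrite (meval_homog _ _ hf) ft mulr0.
Qed.

(** The zero loci of [f] and [h] cover [A], hence one of them contains [A], and it is not that of
    [f]. *)
Lemma irreducible_homog_domain (A : set proj) f d e h : zariski_irreducible A ->
  f \is d.-homog -> h \is e.-homog -> (forall t, cone A t -> f.[! t] * h.[! t] = 0) ->
  (exists2 t, cone A t & f.[! t] != 0) -> forall t, cone A t -> h.[! t] = 0.
Proof.
move=> [_ irrA] hf hh fh [t0 [x0 Ax0 xt0] ft0].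
have cl (g : {mpoly F[m]}) c : g \is c.-homog -> zariski_closed (zero_locus [set g]).
  by move=> hg; exists [set g]; split => // _ ->; exists c.
case: (irrA _ _ (cl f d hf) (cl h e hh)) => [x Ax | Af | Ah t [x Ax xt]].
- have [t nz_t xE] := projective_generator x.
  have At : cone A t by exists x => //; rewrite xE memv_line.
  have /eqP := fh _ At; rewrite mulf_eq0 => /orP[] /eqP z; [left|right].
    by move=> _ s -> ; apply: (meval_homog_point hf xE z).
  by move=> _ s -> ; apply: (meval_homog_point hh xE z).
- by have := Af _ Ax0 _ _ erefl xt0; move/eqP; rewrite (negPf ft0).
- exact: Ah _ Ax _ _ erefl xt.
Qed.

Lemma meval_pihomog (h : {mpoly F[m]}) (t : 'rV[F]_m) a :
  h.[! a *: t] = \sum_(e < msize h) a ^+ e * (pihomog mdeg e h).[! t].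
Proof.
rewrite {1}[h](pihomog_partitionE (mf := mdeg) (leqnn _)) raddf_sum /=.
by apply: eq_bigr => e _; rewrite (meval_homog _ _ (pihomogP _ _ _)).
Qed.

(** Cones are stable under scaling, so the relation splits into homogeneous components, to each of
    which the homogeneous case applies. *)
Lemma irreducible_domain (A : set proj) f d h : zariski_irreducible A ->
  f \is d.-homog -> (forall t, cone A t -> f.[! t] * h.[! t] = 0) ->
  (exists2 t, cone A t & f.[! t] != 0) -> forall t, cone A t -> h.[! t] = 0.
Proof.
move=> irrA hf fh ft t0 At0.
rewrite -[t0]scale1r meval_pihomog big1 // => e _; rewrite expr1n mul1r.
apply: (irreducible_homog_domain irrA hf (pihomogP _ _ _)) ft _ At0 => t At.
(* Up to the factor ['X^d], the polynomial whose value at [a] is the product of [f] and [h] at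
   [a *: t]. *)
pose p : {poly F} := \poly_(e < msize h) (f.[! t] * (pihomog mdeg e h).[! t]).
have p0 : p * 'X^d = 0.
  apply: poly_eq0_horner => a; rewrite hornerM hornerXn horner_poly mulr_suml.
  rewrite -[RHS](fh (a *: t) (cone_scale _ At)) (meval_homog _ _ hf) meval_pihomog.
  by rewrite mulr_sumr; apply: eq_bigr => j _; ring.
have /eqP : p = 0.
  by apply/eqP; move/eqP: p0; rewrite mulf_eq0 expf_eq0 polyX_eq0 andbF orbF.
by move/eqP/(congr1 (fun q : {poly F} => q`_e)); rewrite coef_poly ltn_ord coef0.
Qed.

(** Algebraic independence of the members of [y] as functions on [S]: [M] bounds the exponents, and
    quantifying over it covers all relations. *)
Definition monomials_free (y : seq {mpoly F[m]}) (S : set 'rV[F]_m) : Prop :=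
  forall M (c : nat -> F),
    (forall t, S t -> \sum_(0 <= i < M ^ size y) c i * (monomial M y i).[! t] = 0) ->
    forall i, (i < M ^ size y)%N -> c i = 0.

(** Sort a relation on [B] by powers of [f]. On [A] only the part free of [f] survives, and its
    coefficients vanish by independence there; the rest is divisible by [f], which can be cancelled
    on [B]. *)
Lemma monomials_free_cons f y (A B : set 'rV[F]_m) : A `<=` B ->
  (forall t, A t -> f.[! t] = 0) ->
  (forall h, (forall t, B t -> f.[! t] * h.[! t] = 0) ->
     forall t, B t -> h.[! t] = 0) ->
  monomials_free y A -> monomials_free (f :: y) B.
Proof.
move=> sAB fA fB freeA M c; set K := (M ^ size y)%N.
(* The number [b] of powers of [f] is decoupled from [M], so that the induction can cancel one power
   at a time. *)
have gen b (e : nat -> F) :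
  (forall t, B t -> \sum_(0 <= j < b) f.[! t] ^+ j *
     \sum_(0 <= i < K) e (j * K + i)%N * (monomial M y i).[! t] = 0) ->
  forall j i, (j < b)%N -> (i < K)%N -> e (j * K + i)%N = 0.
  elim: b e => // b IHb e he.
  have e0 i : (i < K)%N -> e i = 0.
    apply: freeA => t At; rewrite -[RHS](he t (sAB _ At)) big_nat_recl //.
    rewrite expr0 mul1r [X in _ = _ + X]big1_seq ?addr0 // => j _.
    by rewrite fA // expr0n mul0r.
  pose h := \sum_(0 <= j < b) f ^+ j *
     \sum_(0 <= i < K) e (j.+1 * K + i)%N *: monomial M y i.
  have hE t : h.[! t] = \sum_(0 <= j < b) f.[! t] ^+ j *
     \sum_(0 <= i < K) e (j.+1 * K + i)%N * (monomial M y i).[! t].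
    rewrite raddf_sum; apply: eq_bigr => j _; rewrite /= mevalM rmorphXn raddf_sum.
    by congr (_ * _); apply: eq_bigr => i _; rewrite /= mevalZ.
  have h0 t : B t -> h.[! t] = 0.
    apply: fB => {}t Bt; rewrite hE -[RHS](he t Bt) big_nat_recl //.
    rewrite expr0 mul1r [X in _ = X + _]big1_seq ?add0r; last first.
      by move=> i; rewrite mem_index_iota => /andP[_ /andP[_ /e0 ->]]; rewrite mul0r.
    by rewrite mulr_sumr; apply: eq_bigr => j _; rewrite exprS mulrA.
  case=> [|j] i lt_jb lt_iK; first by rewrite mul0n e0.
  have := IHb (fun i => e (K + i)%N) _ j i lt_jb lt_iK.
  rewrite mulSn -addnA; apply => t Bt; rewrite -[RHS](h0 t Bt) hE.
  apply: eq_bigr => a _; congr (_ * _); apply: eq_bigr => i' _.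
  by rewrite mulSn addnA.
move=> Hc i; rewrite /= expnS -/K => lt_i.
have K0 : (0 < K)%N by move: lt_i; case: (K) => //; rewrite muln0.
rewrite (divn_eq i K); apply: (gen M); rewrite ?ltn_pmod ?ltn_divLR // => t Bt.
rewrite -[RHS](Hc t Bt) [size (f :: y)]/= expnS sum_nat_mul; apply: eq_bigr => j _.
rewrite mulr_sumr; apply: eq_big_nat => i' /andP[_ lt_i'].
by rewrite monomial_cons // mevalM rmorphXn mulrCA.
Qed.

Lemma chain_monomials_free (X : set proj) e Z : irreducible_chain X e Z ->
  exists2 y, size y = e.+1 & monomials_free y (cone (Z e)).
Proof.
case=> hZ ltZ; have ne i : (i <= e)%N -> Z i !=set0 by move=> /hZ[_ []].
suff: forall i, (i <= e)%N ->
    exists2 y, size y = i.+1 & monomials_free y (cone (Z i)) by apply.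
elim=> [|i IHi] le_ie.
  have [x Zx] := ne 0%N le_ie; have [t nz_t xE] := projective_generator x.
  have [j nz_tj] := rV0Pn _ nz_t.
  (* The induction starts at the origin of the cone, where the empty list is free; this extra level
     yields [e.+1] forms from a chain of length [e]. *)
  exists [:: 'X_j] => //; apply: (@monomials_free_cons _ _ [set 0]).
  - by move=> _ ->; apply: cone0; apply: ne.
  - by move=> _ ->; rewrite mevalXU mxE.
  - move=> h Xh; apply: (irreducible_domain (hZ 0%N le_ie).2 _ Xh).
      by rewrite dhomogX /= mdeg1.
    by exists t; rewrite ?mevalXU //; exists x => //; rewrite xE memv_line.
  - move=> M c /(_ 0 erefl); rewrite /= expn0 big_nat1 meval1 mulr1.
    by move=> c0 [].
have [y sy freey] := IHi (ltnW le_ie).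
have [sZ nZ] := ltZ i le_ie.
have [[C [S [homS ->]] ZiE] _] := hZ i (ltnW le_ie).
have [[C' _ ZSE] irrZ] := hZ i.+1 le_ie.
have [x Zx nZx] : exists2 x, Z i.+1 x & ~ Z i x.
  apply: contrapT => H; apply: nZ => x Zx; apply: contrapT => nZx; apply: H.
  by exists x.
have nS : ~ zero_locus S x.
  by move=> Sx; apply: nZx; rewrite ZiE; split => //; move: Zx; rewrite ZSE => -[].
have [f Sf [t xt nz_ft]] :
    exists2 f, S f & exists2 t, t \in val x & f.[! t] != 0.
  apply: contrapT => H; apply: nS => f t Sf xt; apply/eqP/negPn/negP => nz.
  by apply: H; exists f => //; exists t.
have [d homf] := homS f Sf.
exists (f :: y); first by rewrite /= sy.
apply: monomials_free_cons freey.
- by move=> s [z /sZ Zz zs]; exists z.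
- by move=> s [z]; rewrite ZiE => -[_ Sz] zs; apply: Sz.
- by move=> h fh; apply: (irreducible_domain irrZ homf fh); exists t => //; exists x.
Qed.

End Cones.

(** * Bounds on chains from a parametrisation *)

Section DimensionBounds.
Variables (F : numFieldType) (m : nat) (J : finType).
Variables (X : set (projective_space F m)) (phi : (J -> F) -> 'rV[F]_m).
Local Open Scope classical_set_scope.
Local Notation "f .[! t ]" := (f.@[fun i => t 0 i]) (at level 2, format "f .[! t ]").

Hypothesis polyfun_phi : forall i, polyfun (@coordinate F J) (fun p => phi p 0 i).

(** Composed with [phi], the members of [y] become polynomials in only [#|J|] variables. *)
Lemma image_monomials_dependent (y : seq {mpoly F[m]}) : (#|J| < size y)%N ->
  exists M (c : nat -> F), (exists2 i, (i < M ^ size y)%N & c i != 0) /\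
    forall p, \sum_(0 <= i < M ^ size y) c i * (monomial M y i).[! phi p] = 0.
Proof.
move=> lt_y; have /choice[q hq] := fun i => polyfun_mpoly (polyfun_phi i).
pose lq := [tuple q i | i < m].
have [|M [c [nz_c Hc]]] := @monomial_dependent _ _ [seq f \mPo lq | f <- y].
  by rewrite size_map.
rewrite size_map in nz_c Hc.
have mon_comp i : monomial M [seq f \mPo lq | f <- y] i = monomial M y i \mPo lq.
  elim: y i {lt_y nz_c Hc} => [|f y IHy] i /=; first by rewrite comp_mpoly1.
  by rewrite IHy size_map rmorphM rmorphXn.
exists M, c; split=> // p.
have := congr1 (meval (fun i => p (enum_val i))) Hc.
rewrite raddf_sum meval0 => {2}<-; apply: eq_bigr => i _ /=.
rewrite mevalZ mon_comp comp_mpoly_meval; congr (_ * _).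
by apply: meval_eq => j; rewrite tnth_mktuple hq.
Qed.

(** The second hypothesis places the cone of [X] in the closure of the image of [phi], so a relation
    on the image holds on the cone. Parameters are counted on the cone, hence [d.+1] against the
    projective bound [d]. *)
Lemma chain_length_le d e Z : #|J| = d.+1 ->
  (forall q : {mpoly F[m]}, (forall p, q.[! phi p] = 0) ->
     forall t, cone X t -> q.[! t] = 0) ->
  irreducible_chain X e Z -> (e <= d)%N.
Proof.
move=> cardJ dense chainZ; rewrite leqNgt; apply/negP => lt_de.
have [y sy freey] := chain_monomials_free chainZ.
have [|M [c [[i lt_i nz_ci] Hc]]] := @image_monomials_dependent y.
  by rewrite sy cardJ.
case/eqP: nz_ci; apply: freey lt_i => t [x Zx xt].
pose q := \sum_(0 <= i < M ^ size y) c i *: monomial M y i.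
have qE s : q.[! s] = \sum_(0 <= i < M ^ size y) c i * (monomial M y i).[! s].
  by rewrite raddf_sum; apply: eq_bigr => j _; rewrite /= mevalZ.
rewrite -qE; apply: dense => [p|]; first by rewrite qE.
exists x => //; have [[C _ ZeE] _] := chainZ.1 e (leqnn e).
by move: Zx; rewrite ZeE => -[].
Qed.

(** Data for a lower bound: [chi] cuts out an open set of parameters that [phi] sends into [X], [a0]
    is the base point of the flag, and [f j] detects coordinate [j] as long as the coordinates of
    later stage keep their base value. *)
Variables (stage : J -> nat) (chi : (J -> F) -> F) (a0 : J -> F).
Variable f : J -> {mpoly F[m]}.
Hypotheses (polyfun_chi : polyfun (@coordinate F J) chi) (chi0 : chi a0 != 0).
Hypothesis phiX : forall p, chi p != 0 -> exists2 x, X x & val x = <[phi p]>%VS.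
Hypothesis homog_f : forall j, exists d, f j \is d.-homog.
Hypothesis f_vanishes : forall j p, chi p != 0 -> p j = a0 j ->
  (forall j', (stage j < stage j')%N -> p j' = a0 j') -> (f j).[! phi p] = 0.
Hypothesis f_separates : forall j, exists b,
  [/\ chi b != 0, forall j', j' != j -> b j' = a0 j' & (f j).[! phi b] != 0].

(* The chain is formed by the closures of the images of a flag of coordinate
   subspaces through a0, the coordinates being freed by increasing stage. *)
Lemma flag_chain : exists Z, irreducible_chain X #|J| Z.
Proof.
pose s := sort (relpre stage leq) (enum J).
have index_lt j : (index j s < #|J|)%N.
  by rewrite cardE -(size_sort (relpre stage leq)) index_mem mem_sort mem_enum.
pose L i (p : J -> F) := forall j, (i <= index j s)%N -> p j = a0 j.
(* [Z i] is thus the closure in [X] of the image of the part of the subspace [L i] where [chi] is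
   nonzero. *)
pose I i : set {mpoly F[m]} := [set g | (exists d, g \is d.-homog) /\
  forall p, L i p -> chi p != 0 -> g.[! phi p] = 0].
pose Z i := X `&` zero_locus (I i).
have closedI i : zariski_closed (zero_locus (I i)).
  by exists (I i); split => // g [].
have pointZ i p x : L i p -> chi p != 0 -> X x -> val x = <[phi p]>%VS -> Z i x.
  move=> Lp chip Xx xE; split => // g t [[d hg] Ig].
  by apply: (meval_homog_point hg xE); apply: Ig.
have La0 i : L i a0 by [].
have notI i C : zariski_closed C -> ~ (Z i `<=` C) ->
    exists g, (exists d, g \is d.-homog) /\
      (exists2 p, L i p /\ chi p != 0 & g.[! phi p] != 0) /\
      (forall x t, C x -> t \in val x -> g.[! t] = 0).
  move=> [S [homS ->]] nZC; apply: contrapT => H; apply: nZC => x [Xx xI] g t Sg xt.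
  apply: xI (xt); split; first exact: homS.
  move=> p Lp chip; apply/eqP/negPn/negP => nz; apply: H; exists g.
  split; first exact: homS.
  split; first by exists p.
  by move=> z u Sz; apply: Sz.
exists Z; split=> i lt_i.
  split; first by exists (zero_locus (I i)).
  split.
    have [x Xx xE] := phiX chi0; exists x; exact: pointZ xE.
  move=> C1 C2 clC1 clC2 ZC; apply: contrapT => /not_orP[nC1 nC2].
  have [g1 [_ [[p1 [Lp1 chi1] g1p1] g1C]]] := notI _ _ clC1 nC1.
  have [g2 [_ [[p2 [Lp2 chi2] g2p2] g2C]]] := notI _ _ clC2 nC2.
  have pfg (g : {mpoly F[m]}) :
      polyfun (@coordinate F J) (fun p => g.[! phi p]).
    by apply: polyfun_meval.
  (* A line inside [L i] joins the two witnesses. Along it the product of [g1], [g2] and [chi] is a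
     nonzero polynomial, so some point of it lies in neither closed set. *)
  pose line u j := p1 j + u * (p2 j - p1 j).
  have Lline u : L i (line u) by move=> j ij; rewrite /line Lp1 // Lp2 // subrr mulr0 addr0.
  have [u [gu chiu]] : exists u, g1.[! phi (line u)] * g2.[! phi (line u)] != 0
       /\ chi (line u) != 0.
    have line0 : line 0 = p1 by apply/funext => j; rewrite /line mul0r addr0.
    have line1 : line 1 = p2 by apply/funext => j; rewrite /line mul1r addrC subrK.
    have pl h : polyfun (@coordinate F J) h -> polyfun (eq id) (fun u => h (line u)).
      exact: polyfun_line.
    have [] := @polyfun_mul_neq0 F
      (fun u => g1.[! phi (line u)] * g2.[! phi (line u)]) (fun u => chi (line u)).
    - by apply: polyfun_mul; apply: (pl (fun p => _.[! phi p])); apply: pfg.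
    - exact: pl.
    - apply: polyfun_mul_neq0; try by apply: (pl (fun p => _.[! phi p])); apply: pfg.
        by exists 0; rewrite line0.
      by exists 1; rewrite line1.
    - by exists 0; rewrite line0.
    - by move=> u; rewrite mulf_eq0 negb_or => /andP[? ?]; exists u.
  have [x Xx xE] := phiX chiu.
  have xt : phi (line u) \in val x by rewrite xE memv_line.
  case: (ZC x (pointZ i _ x (Lline u) chiu Xx xE)) => [/g1C|/g2C] /(_ _ xt) z.
    by rewrite z mul0r eqxx in gu.
  by rewrite z mulr0 eqxx in gu.
split.
  move=> x [Xx xI]; split=> // g t [hg Ig]; apply: xI; split=> // p Lp.
  by apply: Ig => j /ltnW; apply: Lp.
have [j0 _] : exists j : J, True by case/card_gt0P: (leq_ltn_trans (leq0n i) lt_i) => j; exists j.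
pose j := nth j0 s i.
have size_s : size s = #|J| by rewrite size_sort cardE.
have uniq_s : uniq s by rewrite sort_uniq enum_uniq.
have ind_j : index j s = i by rewrite index_uniq ?size_s.
have [b [chib bE fb]] := f_separates j.
have [x Xx xE] := phiX chib.
(* The image of [b] lies in [Z i.+1], whereas [f j] belongs to [I i] and does not vanish there. *)
move=> /(_ x) H; have /H[_ /(_ (f j) (phi b))] : Z i.+1 x.
  apply: (pointZ i.+1 b) => // j'; rewrite -ind_j => lt_j'.
  by apply: bE; apply/eqP => jj'; rewrite jj' ltnn in lt_j'.
rewrite xE memv_line => fb0; case/eqP: fb; apply: fb0 => //.
split=> // p Lp chip; apply: f_vanishes => // [|j' lt_j']; apply: Lp.
  by rewrite ind_j.
rewrite leqNgt; apply/negP => lt_ind; have : (stage j' <= stage j)%N; last first.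
  by rewrite leqNgt lt_j'.
have sorted_s : sorted (relpre stage leq) s.
  by apply: sort_sorted => u v; apply: leq_total.
have := sorted_leq_index (leT := relpre stage leq) _ _ sorted_s.
move=> /(_ _ _ j' j); apply => //; last by rewrite ind_j ltnW.
- by move=> u v w; apply: leq_trans.
- by move=> u; apply: leqnn.
- by rewrite mem_sort mem_enum.
- by rewrite mem_sort mem_enum.
Qed.

End DimensionBounds.

(** * Determinants *)

Section Adjugate.
Variable F : fieldType.

Lemma adj_mul_domain (R : idomainType) n (A B : 'M[R]_n) :
  \det A != 0 -> \det B != 0 -> \adj (A *m B) = \adj B *m \adj A.
Proof.
move=> nzA nzB.
have H : (\adj (A *m B) - \adj B *m \adj A) *m (A *m B) = 0.
  rewrite mulmxBl mul_adj_mx -mulmxA (mulmxA _ A) mul_adj_mx mul_scalar_mx.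
  by rewrite -scalemxAr mul_adj_mx scale_scalar_mx det_mulmx subrr.
apply/eqP; rewrite -subr_eq0; set C := _ - _ in H *.
have : C *m ((A *m B) *m \adj (A *m B)) = 0 by rewrite mulmxA H mul0mx.
rewrite mul_mx_adj mul_mx_scalar => /eqP; rewrite scalemx_eq0 det_mulmx mulf_eq0.
by rewrite (negPf nzA) (negPf nzB).
Qed.

(* Both sides are values at 0 of the same identity for A + X and B + X, whose
   determinants are monic. *)
Lemma adj_mul n (A B : 'M[F]_n) : \adj (A *m B) = \adj B *m \adj A.
Proof.
pose L (M : 'M[F]_n) := char_poly_mx (- M).
have L0 M : map_mx (horner_eval 0) (L M) = M.
  apply/matrixP => i j; rewrite !mxE /horner_eval /= hornerD hornerN hornerC opprK.
  by rewrite hornerMn hornerX mul0rn add0r.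
have nzL M : \det (L M) != 0 by apply/monic_neq0/char_poly_monic.
rewrite -[in LHS](L0 A) -[in LHS](L0 B) -map_mxM -map_mx_adj adj_mul_domain //.
by rewrite map_mxM !map_mx_adj !L0.
Qed.

(** The derivative of the determinant at [P] in the direction [Q], by Jacobi's formula. *)
Definition dirder n (P Q : 'M[F]_n) : F := \tr (Q *m \adj P).

Lemma sum_det_replace_row n (P Q : 'M[F]_n) :
  \sum_i \det (replace_row P Q i) = dirder P Q.
Proof.
apply: eq_bigr => i _; rewrite (expand_det_row _ i) mxE; apply: eq_bigr => j _.
rewrite !mxE eqxx; congr (_ * (_ * \det _)); apply/matrixP => a b.
by rewrite !mxE eq_sym (negPf (neq_lift _ _)).
Qed.

Lemma dirder_mul n (g P Q : 'M[F]_n) : dirder (g *m P) (g *m Q) = \det g * dirder P Q.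
Proof.
rewrite /dirder adj_mul mulmxA mxtrace_mulC !mulmxA mul_adj_mx -mulmxA.
by rewrite mul_scalar_mx mxtraceZ.
Qed.

Lemma dirder_shift n (P Q Z : 'M[F]_n) :
  dirder P (Q + Z *m P) = dirder P Q + \tr Z * \det P.
Proof.
rewrite /dirder mulmxDl mxtraceD -mulmxA mul_mx_adj mul_mx_scalar mxtraceZ.
by rewrite mulrC.
Qed.

Lemma dirder_scale n a (P Q : 'M[F]_n) : dirder P (a *: Q) = a * dirder P Q.
Proof. by rewrite /dirder -scalemxAl mxtraceZ. Qed.

Lemma det_schur a b (A : 'M[F]_(a, b)) (B : 'M_(b, a)) (P : 'M_b) (Z : 'M_a) :
  P \in unitmx -> \det (block_mx Z (- A) B P) = \det P * \det (Z + A *m invmx P *m B).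
Proof.
move=> uP.
have -> : block_mx Z (- A) B P =
    block_mx 1%:M (- A *m invmx P) 0 1%:M *m block_mx (Z + A *m invmx P *m B) 0 B P.
  by rewrite mulmx_block !mul1mx !mul0mx !add0r !mulNmx mulmxKV // addrK.
by rewrite det_mulmx det_ublock det_lblock !det1 !mul1r mulrC.
Qed.

(** Sylvester's identity: the two sides come from the two Schur complements of the block matrix with
    rows [[1, -A]] and [[B, 1]]. *)
Lemma det1D_comm a b (A : 'M[F]_(a, b)) (B : 'M_(b, a)) :
  \det (1%:M + A *m B) = \det (1%:M + B *m A).
Proof.
have := @det_schur _ _ A B 1%:M 1%:M (unitmx1 _ _).
rewrite invmx1 mulmx1 det1 mul1r => <-.
have -> : block_mx 1%:M (- A) B 1%:M =
    block_mx 1%:M 0 B 1%:M *m block_mx 1%:M (- A) 0 (1%:M + B *m A).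
  rewrite mulmx_block !mul1mx !mul0mx !mulmx1 !addr0 mulmxN.
  by rewrite addrC addrK.
by rewrite det_mulmx det_lblock det_ublock !det1 !mul1r.
Qed.

End Adjugate.

(** * Perturbations of rank at most two *)

Section Rank2.
Variable F : numFieldType.

Lemma det_shift_neq0 n (A : 'M[F]_n) : exists u, \det (A + u%:M) != 0.
Proof.
apply: contrapT => none; have : char_poly (- A) = 0; last first.
  by apply/eqP/monic_neq0/char_poly_monic.
apply: poly_eq0_horner => u; rewrite -[_.[u]]/(horner_eval u _) -det_map_mx.
apply/eqP/negPn/negP => nz; apply: none; exists u.
suff <- : map_mx (horner_eval u) (char_poly_mx (- A)) = A + u%:M by [].
apply/matrixP => i j; rewrite !mxE /horner_eval /= hornerD hornerN hornerC opprK.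
by rewrite hornerMn hornerX addrC.
Qed.

Lemma det1D_scale2 (S : 'M[F]_2) v :
  \det (1%:M + v *: S) = 1 + v * \tr S + v ^+ 2 * \det S.
Proof.
have det2 (A : 'M[F]_2) : \det A = A 0 0 * A 1 1 - A 0 1 * A 1 0.
  rewrite (expand_det_row _ 0) !big_ord_recl big_ord0 addr0 /cofactor !det_mx11 !mxE.
  have -> : lift 0 0 = 1 :> 'I_2 by apply/val_inj.
  have -> : lift 1 0 = 0 :> 'I_2 by apply/val_inj.
  rewrite /= expr0 expr1; ring.
rewrite !det2 /mxtrace !big_ord_recl big_ord0 !mxE /=.
have -> : lift ord0 ord0 = 1 :> 'I_2 by apply/val_inj.
ring.
Qed.

(** For invertible [P], Sylvester's identity reduces the determinant to size 2, where it is
    quadratic in [v], and the bordered determinant is a Schur complement. Both sides are polynomial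
    in [P], so scalar shifts of [P] reach the singular case. *)
Lemma det_add_rank2 n (P : 'M[F]_n) (X : 'M_(n, 2)) (H : 'M_2) (Y : 'M_(2, n)) v :
  \det (P + v *: (X *m H *m Y)) = \det P + v * dirder P (X *m H *m Y)
    + v ^+ 2 * (\det H * \det (block_mx 0 (- Y) X P)).
Proof.
pose lhs Q := \det (Q + v *: (X *m H *m Y)).
pose rhs Q := \det Q + v * dirder Q (X *m H *m Y)
    + v ^+ 2 * (\det H * \det (block_mx 0 (- Y) X Q)).
suff unit_case Q : \det Q != 0 -> lhs Q - rhs Q = 0.
  pose Pu u := P + u *: 1%:M.
  suff /(_ 0) : forall u, lhs (Pu u) - rhs (Pu u) = 0.
    by rewrite /Pu scale0r addr0 => /eqP; rewrite subr_eq0 => /eqP.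
  have pfP : polyfun_mx (eq id) Pu.
    apply: polyfun_mx_add; first exact: polyfun_mx_const.
    by apply: polyfun_mx_scale; [exact: polyfun_gen | exact: polyfun_mx_const].
  apply: (@polyfun_zero_off _ (fun u => lhs (Pu u) - rhs (Pu u))
                            (fun u => \det (Pu u))).
  - apply: polyfun_sub.
      apply: polyfun_det; apply: polyfun_mx_add => //; exact: polyfun_mx_const.
    apply: polyfun_add; first apply: polyfun_add.
    + exact: polyfun_det.
    + apply: polyfun_mul; first exact: polyfun_const.
      apply: polyfun_sum => i.
      apply: (@polyfun_mx_mul _ _ _ _ _ _ (fun=> X *m H *m Y)).
        exact: polyfun_mx_const.
      exact: polyfun_adj.
    + apply: polyfun_mul; first exact: polyfun_const.
      apply: polyfun_mul; first exact: polyfun_const.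
      apply: polyfun_det; apply: polyfun_mx_col; apply: polyfun_mx_row => //;
      exact: polyfun_mx_const.
  - exact: polyfun_det.
  - by have [u] := det_shift_neq0 P; rewrite -scalemx1; exists u.
  - by move=> w; apply: unit_case.
rewrite -unitfE -unitmxE => uQ.
pose S := Y *m invmx Q *m X *m H.
have -> : lhs Q = \det Q * \det (1%:M + v *: S).
  have -> : v *: S = (v *: Y *m invmx Q) *m (X *m H) by rewrite -!scalemxAl !mulmxA.
  rewrite det1D_comm mulrC -det_mulmx mulmxDl mul1mx /lhs -(mulmxA (X *m H)) mulmxKV //.
  by rewrite -scalemxAr.
have -> : rhs Q = \det Q * (1 + v * \tr S + v ^+ 2 * \det S).
  rewrite /rhs det_schur // add0r !det_mulmx.
  have -> : dirder Q (X *m H *m Y) = \det Q * \tr S.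
    have adjQ : \adj Q = \det Q *: invmx Q.
      by rewrite /invmx uQ scalerA divff ?scale1r // -unitfE -unitmxE.
    rewrite /dirder adjQ -scalemxAr mxtraceZ -(mulmxA (X *m H)).
    by rewrite mxtrace_mulC !mulmxA.
  ring.
apply/eqP; rewrite subr_eq0; apply/eqP; congr (_ * _).
exact: det1D_scale2.
Qed.

(** The linear term is absorbed by moving to [P']; what is left is the quadratic term of
    [det_add_rank2] with the opposite sign. *)
Lemma dirder_rank2 n c (P : 'M[F]_n) (X : 'M_(n, 2)) (H : 'M_2) (Y : 'M_(2, n)) :
  c != 0 -> let P' := P + c^-1 *: (X *m H *m Y) in
  c * \det P + dirder P (X *m H *m Y) =
  c * \det P' - c^-1 * \det H * \det (block_mx 0 (- Y) X P').
Proof.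
move=> nz_c P'; have -> : \det (block_mx 0 (- Y) X P') = \det (block_mx 0 (- Y) X P).
  (* Adding combinations of the bordering columns to the others turns [P] into [P']. *)
  have -> : block_mx 0 (- Y) X P' =
      block_mx 0 (- Y) X P *m block_mx 1%:M (c^-1 *: (H *m Y)) 0 1%:M.
    rewrite mulmx_block !mul0mx !mulmx0 !mulmx1 !add0r !addr0.
    by rewrite -scalemxAr mulmxA addrC.
  by rewrite det_mulmx det_ublock !det1 !mulr1.
rewrite /P' det_add_rank2; field.
by [].
Qed.

End Rank2.

(** * Tangent vectors and the upper bound *)

Section TangentVectors.
Variables (F : numFieldType) (k N : nat).
Implicit Types V Phi : 'M[F]_(k, N).

Definition tangent_vector c V Phi : 'rV[F]_(extdim k N) :=
  c *: wedge V + \sum_i wedge (replace_row V Phi i).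

Lemma wedge_coord V (e : 'I_(extdim k N)) : (wedge V) 0 e = \det (colsub (val (enum_val e)) V).
Proof. by rewrite mxE. Qed.

Lemma tangent_vector_coord c V Phi (e : 'I_(extdim k N)) : let g := colsub (val (enum_val e)) in
  (tangent_vector c V Phi) 0 e = c * \det (g V) + dirder (g V) (g Phi).
Proof.
rewrite /= !mxE summxE -sum_det_replace_row; congr (_ + _).
apply: eq_bigr => i _; rewrite wedge_coord; congr (\det _).
by apply/matrixP => a b; rewrite !mxE.
Qed.

Lemma colsub_mul p q r (g : 'I_r -> 'I_q) (A : 'M[F]_(p, k)) (B : 'M_(k, q)) :
  colsub g (A *m B) = A *m colsub g B.
Proof. by apply/matrixP => i j; rewrite !mxE; apply: eq_bigr => l _; rewrite mxE. Qed.

Lemma tangent_vector_mul c (g : 'M_k) V Phi :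
  tangent_vector c (g *m V) (g *m Phi) = \det g *: tangent_vector c V Phi.
Proof.
apply/rowP => e; rewrite [in RHS]mxE !tangent_vector_coord !colsub_mul dirder_mul det_mulmx.
by ring.
Qed.

(** Rows in the row space of [V] do not change the homomorphism; they only move the vector along
    [wedge V], by the trace. *)
Lemma tangent_vector_shift c V Phi (Z : 'M_k) :
  tangent_vector c V (Phi + Z *m V) = tangent_vector (c + \tr Z) V Phi.
Proof.
apply/rowP => e; rewrite !tangent_vector_coord /= linearD /= colsub_mul dirder_shift.
by ring.
Qed.

Lemma tangent_vector_scale a c V Phi :
  a *: tangent_vector c V Phi = tangent_vector (a * c) V (a *: Phi).
Proof.
apply/rowP => e; rewrite [LHS]mxE !tangent_vector_coord /= linearZ /= dirder_scale.
by ring.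
Qed.

Lemma polyfun_tangent_vector T (G : (T -> F) -> Prop) (c : T -> F)
    (V Phi : T -> 'M[F]_(k, N)) :
  polyfun G c -> polyfun_mx G V -> polyfun_mx G Phi ->
  forall e, polyfun G (fun t => (tangent_vector (c t) (V t) (Phi t)) 0 e).
Proof.
move=> pfc pfV pfPhi e; set g := val (enum_val e).
apply: (@polyfun_ext _ _ _ (fun t => c t * \det (colsub g (V t))
    + \tr (colsub g (Phi t) *m \adj (colsub g (V t))))) => [t|].
  by rewrite tangent_vector_coord.
have pfg := @polyfun_mx_sub _ _ G k N k k id g.
apply: polyfun_add.
  by apply: polyfun_mul => //; apply: polyfun_det; apply: pfg.
apply: polyfun_sum => i; apply: polyfun_mx_mul; first exact: pfg.
by apply: polyfun_adj; apply: pfg.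
Qed.

(** The row base of [Phi *m cokermx V] lifts to [Y] through [cokermx V]; the remainder is killed by
    [cokermx V], so its rows lie in the row space of [V]. *)
Lemma rank_mod_factor l V Phi : hom_rank V Phi = l ->
  exists (X : 'M_(k, l)) (Y : 'M_(l, N)) (Z : 'M_k), Phi = X *m Y + Z *m V.
Proof.
rewrite /hom_rank; set M := Phi *m cokermx V => <-.
have /submxP[Y YE] : (row_base M <= cokermx V)%MS.
  by rewrite eq_row_base submxMl.
exists (col_base M), Y.
have /submxP[Z ZE] : (Phi - col_base M *m Y <= V)%MS.
  by rewrite submxE mulmxBl -mulmxA -YE mulmx_base subrr.
by exists Z; rewrite -ZE addrC subrK.
Qed.

(** The part of [Phi] along [V] goes into [c], and the scalar of the line into [Y]. Only a
    factorisation through size [l] is kept of the rank condition, which suffices for an upper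
    bound. *)
Lemma cone_tangent_orbit l z : cone (tangent_orbit F k N l) z ->
  exists c V (X : 'M_(k, l)) (Y : 'M_(l, N)), z = tangent_vector c V (X *m Y).
Proof.
case=> x [p [V [t [Phi [[_ _ xE] [_ [c tE] /rank_mod_factor[X [Y [Z PhiE]]]]]]]]].
rewrite xE => /vlineP[a ->]; exists (a * (c + \tr Z)), V, X, (a *: Y).
by rewrite -scalemxAr -tangent_vector_scale -tangent_vector_shift -PhiE /tangent_vector -tE.
Qed.

End TangentVectors.

(** * Density of the normalised tangent vectors *)

Section Density.
Variables (F : numFieldType).
Local Notation "f .[! t ]" := (f.@[fun i => t 0 i]) (at level 2, format "f .[! t ]").

(** [h + u%:M] is invertible outside the zeros of a nonzero polynomial in [u], so [q] vanishes along
    all of [z]. *)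
Lemma density_pencil a m (q : {mpoly F[m]}) (h : 'M[F]_a) (z : F -> 'rV[F]_m) :
  (forall e, polyfun (eq id) (fun u => z u 0 e)) ->
  (forall u, h + u%:M \in unitmx -> q.[! z u] = 0) -> q.[! z 0] = 0.
Proof.
move=> pfz hz; apply: (@polyfun_zero_off _ (fun u => q.[! z u])
    (fun u => \det (h + u *: 1%:M))).
- exact: polyfun_meval.
- apply: polyfun_det; apply: polyfun_mx_add; first exact: polyfun_mx_const.
  by apply: polyfun_mx_scale; [exact: polyfun_gen | exact: polyfun_mx_const].
- by have [u] := det_shift_neq0 h; rewrite -(scalemx1 _ u); exists u.
- by move=> u; rewrite scalemx1 -unitfE -unitmxE; apply: hz.
Qed.

Variables (k' l n : nat).
Local Notation k := (l + k')%N.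
Local Notation N := (k + n)%N.
Variable q : {mpoly F[extdim k N]}.

Definition chart_vector c (A : 'M[F]_(k, n)) (D : 'M[F]_(k', l)) (M : 'M[F]_(l, n)) :=
  tangent_vector c (row_mx 1%:M A) (row_mx 0 (col_mx 1%:M D *m M)).

Hypothesis q_chart : forall c A D M, q.[! chart_vector c A D M] = 0.

(** Normalisation, read from [step4] back to [step1]: a change of basis makes the left block of [V]
    the identity, a change of factorisation does the same for the top of [X], and subtracting a
    multiple of [V] clears the left block of [Phi]. Pencils supply the invertible blocks used by the
    first two. *)
Lemma chart_dense c V (X : 'M_(k, l)) (Y : 'M_(l, N)) :
  q.[! tangent_vector c V (X *m Y)] = 0.
Proof.
have step1 c1 (A : 'M_(k, n)) D Y1 :
    q.[! tangent_vector c1 (row_mx 1%:M A) (col_mx 1%:M D *m Y1)] = 0.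
  set X1 := col_mx _ _; rewrite -(hsubmxK Y1); set Y1l := lsubmx _; set Y1r := rsubmx _.
  have -> : X1 *m row_mx Y1l Y1r =
      row_mx 0 (X1 *m (Y1r - Y1l *m A)) + (X1 *m Y1l) *m row_mx 1%:M A.
    rewrite !mul_mx_row add_row_mx mulmx1 add0r mulmxBr -!mulmxA.
    by rewrite subrK.
  by rewrite tangent_vector_shift q_chart.
have step2 c1 (A : 'M_(k, n)) (X1 : 'M_(k, l)) (Y1 : 'M_(l, N)) : usubmx X1 \in unitmx ->
    q.[! tangent_vector c1 (row_mx 1%:M A) (X1 *m Y1)] = 0.
  move=> uX; have -> : X1 = col_mx 1%:M (dsubmx X1 *m invmx (usubmx X1)) *m usubmx X1.
    by rewrite mul_col_mx mul1mx mulmxKV // vsubmxK.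
  by rewrite -mulmxA step1.
have step3 c1 (A : 'M_(k, n)) (X1 : 'M_(k, l)) (Y1 : 'M_(l, N)) :
    q.[! tangent_vector c1 (row_mx 1%:M A) (X1 *m Y1)] = 0.
  pose z u := tangent_vector c1 (row_mx 1%:M A) ((X1 + u *: col_mx 1%:M 0) *m Y1).
  have -> : tangent_vector c1 (row_mx 1%:M A) (X1 *m Y1) = z 0.
    by rewrite /z scale0r addr0.
  apply: (@density_pencil _ _ _ (usubmx X1)) => [e|u uX]; last first.
    by apply: step2; rewrite linearD linearZ /= col_mxKu scalemx1.
  apply: polyfun_tangent_vector; [exact: polyfun_const | exact: polyfun_mx_const |].
  apply: polyfun_mx_mul; last exact: polyfun_mx_const.
  apply: polyfun_mx_add; first exact: polyfun_mx_const.
  by apply: polyfun_mx_scale; [exact: polyfun_gen | exact: polyfun_mx_const].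
have step4 c1 V1 (X1 : 'M_(k, l)) (Y1 : 'M_(l, N)) : lsubmx V1 \in unitmx ->
    q.[! tangent_vector c1 V1 (X1 *m Y1)] = 0.
  move=> ug; set g := lsubmx V1 in ug.
  have -> : V1 = g *m row_mx 1%:M (invmx g *m rsubmx V1).
    by rewrite mul_mx_row mulmx1 mulKVmx // hsubmxK.
  have -> : X1 *m Y1 = g *m ((invmx g *m X1) *m Y1) by rewrite !mulmxA mulmxV ?mul1mx.
  by rewrite tangent_vector_mul tangent_vector_scale scalemxAr; apply: step3.
pose z u := tangent_vector c (V + u *: row_mx 1%:M 0) (X *m Y).
have -> : tangent_vector c V (X *m Y) = z 0 by rewrite /z scale0r addr0.
apply: (@density_pencil _ _ _ (lsubmx V)) => [e|u uV]; last first.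
  by apply: step4; rewrite linearD linearZ /= row_mxKl scalemx1.
apply: polyfun_tangent_vector; [exact: polyfun_const | | exact: polyfun_mx_const].
apply: polyfun_mx_add; first exact: polyfun_mx_const.
by apply: polyfun_mx_scale; [exact: polyfun_gen | exact: polyfun_mx_const].
Qed.

End Density.

Section MatrixCoordinates.
Variables (F : comNzRingType) (J : Type) (a b : nat) (e : 'I_a * 'I_b -> J).

Definition mxcoord (p : J -> F) : 'M[F]_(a, b) := \matrix_(i, j) p (e (i, j)).

Lemma polyfun_mxcoord : polyfun_mx (@coordinate F J) mxcoord.
Proof.
move=> i j; apply: (@polyfun_ext _ _ _ (fun p => p (e (i, j)))) => [p|].
  by rewrite mxE.
by apply: polyfun_gen; exists (e (i, j)).
Qed.

Lemma mxcoordE p (M : 'M[F]_(a, b)) : (forall i j, p (e (i, j)) = M i j) -> mxcoord p = M.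
Proof. by move=> pM; apply/matrixP => i j; rewrite mxE pM. Qed.

End MatrixCoordinates.

Section UpperBounds.
Variables (F : numFieldType).
Local Notation "f .[! t ]" := (f.@[fun i => t 0 i]) (at level 2, format "f .[! t ]").

Lemma tangent_orbit_chain_le l k' n e Z :
  irreducible_chain (tangent_orbit F (l + k') (l + k' + n) l) e Z ->
  (e <= (l + k') * n + k' * l + l * n)%N.
Proof.
set k := (l + k')%N.
(* The [unit] summand is the coefficient [c]; it makes [#|J|] one more than the bound, as
   [chain_length_le] demands. *)
pose J := (unit + 'I_k * 'I_n + ('I_k' * 'I_l + 'I_l * 'I_n))%type.
pose A (p : J -> F) := mxcoord (fun x : 'I_k * 'I_n => inl (inr x)) p.
pose D (p : J -> F) := mxcoord (fun x : 'I_k' * 'I_l => inr (inl x)) p.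
pose M (p : J -> F) := mxcoord (fun x : 'I_l * 'I_n => inr (inr x)) p.
apply: (@chain_length_le _ _ _ _ (fun p : J -> F =>
    chart_vector (p (inl (inl tt))) (A p) (D p) (M p))).
- apply: polyfun_tangent_vector.
  + by apply: polyfun_gen; exists (inl (inl tt)).
  + by apply: polyfun_mx_row; [exact: polyfun_mx_const | exact: polyfun_mxcoord].
  + apply: polyfun_mx_row; first exact: polyfun_mx_const.
    apply: polyfun_mx_mul; last exact: polyfun_mxcoord.
    by apply: polyfun_mx_col; [exact: polyfun_mx_const | exact: polyfun_mxcoord].
- by rewrite !card_sum !card_prod card_unit !card_ord; ring.
- move=> q q0 t /cone_tangent_orbit[c [V [X [Y ->]]]].
  apply: chart_dense => c1 A1 D1 M1.
  pose p (j : J) : F := match j with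
    | inl (inl _) => c1 | inl (inr x) => A1 x.1 x.2
    | inr (inl x) => D1 x.1 x.2 | inr (inr x) => M1 x.1 x.2 end.
  have := q0 p; have -> : A p = A1 by apply: mxcoordE.
  have -> : D p = D1 by apply: mxcoordE.
  by have -> : M p = M1 by apply: mxcoordE.
Qed.

Section Rank2.
Variables k' n' : nat.
Local Notation k := (2 + k')%N.
Local Notation n := (2 + n')%N.
Local Notation N := (k + n)%N.

(* With V' = V + Phi / c, the terms linear in Phi cancel: only c V' and the
   quadratic term survive, and the latter sees of Phi = X H Y only det H. *)
Definition rank2_vector (c m : F) (A : 'M[F]_(k, n)) (D : 'M[F]_(k', 2))
    (E : 'M[F]_(2, n')) : 'rV[F]_(extdim k N) :=
  \row_(e < extdim k N) let g := val (enum_val e) in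
    (c * \det (colsub g (row_mx 1%:M A))
     - m * \det (block_mx 0 (- colsub g (row_mx 0 (row_mx 1%:M E)))
                    (col_mx 1%:M D) (colsub g (row_mx 1%:M A)))).

(** Splitting off the square block [H] of [M] leaves [E]; then [dirder_rank2] applies to each
    coordinate, the shift of [P] becoming a shift of [A]. *)
Lemma chart_vector_rank2 c A D (M : 'M[F]_(2, n)) : c != 0 -> lsubmx M \in unitmx ->
  exists m A' E, chart_vector c A D M = rank2_vector c m A' D E.
Proof.
move=> nz_c uM; pose H := lsubmx M; pose E := invmx H *m rsubmx M.
have ME : M = H *m row_mx 1%:M E by rewrite mul_mx_row mulmx1 mulKVmx // hsubmxK.
pose X : 'M[F]_(k, 2) := col_mx 1%:M D.
exists (c^-1 * \det H), (A + c^-1 *: (X *m M)), E.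
apply/rowP => e; rewrite tangent_vector_coord [RHS]mxE /=.
set g : 'I_k -> 'I_N := val (enum_val e).
pose Y : 'M[F]_(2, N) := row_mx 0 (row_mx 1%:M E).
have gPhi : colsub g (row_mx 0 (X *m M)) = X *m H *m colsub g Y.
  by rewrite -colsub_mul mul_mx_row mulmx0 ME mulmxA.
rewrite gPhi (dirder_rank2 _ _ _ _ nz_c) /=.
suff -> : colsub g (row_mx 1%:M A) + c^-1 *: (X *m H *m colsub g Y)
    = colsub g (row_mx 1%:M (A + c^-1 *: (X *m M))) by [].
by rewrite -gPhi -linearZ -linearD /= scale_row_mx add_row_mx scaler0 addr0.
Qed.

Lemma rank2_dense (q : {mpoly F[extdim k N]}) :
  (forall c m A D E, q.[! rank2_vector c m A D E] = 0) ->
  forall c A D M, q.[! @chart_vector F k' 2 n c A D M] = 0.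
Proof.
move=> q0.
have step1 c A D (M : 'M[F]_(2, n)) : c != 0 -> lsubmx M \in unitmx ->
    q.[! chart_vector c A D M] = 0.
  by move=> nz_c uM; have [m [A' [E ->]]] := chart_vector_rank2 A D nz_c uM.
have step2 c A D (M : 'M[F]_(2, n)) : c != 0 -> q.[! chart_vector c A D M] = 0.
  move=> nz_c; pose z u := chart_vector c A D (M + u *: row_mx 1%:M 0).
  have -> : chart_vector c A D M = z 0 by rewrite /z scale0r addr0.
  apply: (@density_pencil _ _ _ _ (lsubmx M)) => [e|u uM]; last first.
    by apply: step1; rewrite // linearD linearZ /= row_mxKl scalemx1.
  apply: polyfun_tangent_vector; [exact: polyfun_const | exact: polyfun_mx_const|].
  apply: polyfun_mx_row; first exact: polyfun_mx_const.
  apply: polyfun_mx_mul; first exact: polyfun_mx_const.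
  apply: polyfun_mx_add; first exact: polyfun_mx_const.
  by apply: polyfun_mx_scale; [exact: polyfun_gen | exact: polyfun_mx_const].
move=> c A D M; pose z u := chart_vector (c + u) A D M.
have -> : chart_vector c A D M = z 0 by rewrite /z addr0.
(* That [c + u] is nonzero is the invertibility of a pencil of size 1. *)
apply: (@density_pencil _ _ _ _ (c%:M : 'M_1)) => [e|u].
  apply: polyfun_tangent_vector; try exact: polyfun_mx_const.
  by apply: polyfun_add; [exact: polyfun_const | exact: polyfun_gen].
by rewrite unitmxE det_mx11 !mxE eqxx unitfE => nz_cu; apply: step2.
Qed.

Lemma tangent_orbit2_chain_le e Z :
  irreducible_chain (tangent_orbit F k N 2) e Z ->
  (e <= k * n + 2 * k' + 2 * n' + 1)%N.
Proof.
(* The two [unit] summands are [c] and [m]; the single [m] replaces the four entries of the square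
   block of [M]. *)
pose J := (unit + 'I_k * 'I_n + (unit + ('I_k' * 'I_2 + 'I_2 * 'I_n')))%type.
pose A (p : J -> F) := mxcoord (fun x : 'I_k * 'I_n => inl (inr x)) p.
pose D (p : J -> F) := mxcoord (fun x : 'I_k' * 'I_2 => inr (inr (inl x))) p.
pose E (p : J -> F) := mxcoord (fun x : 'I_2 * 'I_n' => inr (inr (inr x))) p.
apply: (@chain_length_le _ _ _ _ (fun p : J -> F =>
    rank2_vector (p (inl (inl tt))) (p (inr (inl tt))) (A p) (D p) (E p))).
- move=> i; set g := val (enum_val i).
  have pfV : polyfun_mx (@coordinate F J) (fun p => colsub g (row_mx 1%:M (A p))).
    apply: polyfun_mx_sub.
    by apply: polyfun_mx_row; [exact: polyfun_mx_const | exact: polyfun_mxcoord].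
  apply: (@polyfun_ext _ _ _ (fun p : J -> F =>
      p (inl (inl tt)) * \det (colsub g (row_mx 1%:M (A p)))
      - p (inr (inl tt)) *
        \det (block_mx 0 (- colsub g (row_mx 0 (row_mx 1%:M (E p))))
                 (col_mx 1%:M (D p)) (colsub g (row_mx 1%:M (A p)))))) => [p|].
    by rewrite mxE.
  apply: polyfun_sub; apply: polyfun_mul.
  + by apply: polyfun_gen; exists (inl (inl tt)).
  + exact: polyfun_det.
  + by apply: polyfun_gen; exists (inr (inl tt)).
  + apply: polyfun_det; apply: polyfun_mx_col; apply: polyfun_mx_row => //.
    * exact: polyfun_mx_const.
    * apply: polyfun_mx_opp; apply: polyfun_mx_sub.
      apply: polyfun_mx_row; first exact: polyfun_mx_const.
      by apply: polyfun_mx_row; [exact: polyfun_mx_const | exact: polyfun_mxcoord].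
    * by apply: polyfun_mx_col; [exact: polyfun_mx_const | exact: polyfun_mxcoord].
- by rewrite !card_sum !card_prod card_unit !card_ord; ring.
- move=> q q0 t /cone_tangent_orbit[c [V [X [Y ->]]]].
  apply: chart_dense; apply: rank2_dense => c1 m1 A1 D1 E1.
  pose p (j : J) : F := match j with
    | inl (inl _) => c1 | inl (inr x) => A1 x.1 x.2 | inr (inl _) => m1
    | inr (inr (inl x)) => D1 x.1 x.2 | inr (inr (inr x)) => E1 x.1 x.2 end.
  have := q0 p; have -> : A p = A1 by apply: mxcoordE.
  have -> : D p = D1 by apply: mxcoordE.
  by have -> : E p = E1 by apply: mxcoordE.
Qed.

End Rank2.
End UpperBounds.

(** * The lower bound *)

Section LinearForms.
Variables (F : numFieldType) (k N : nat).
Local Notation "f .[! t ]" := (f.@[fun i => t 0 i]) (at level 2, format "f .[! t ]").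

Lemma sort_ordfun (h : 'I_k -> 'I_N) : injective h ->
  exists s : 'S_k, forall i j : 'I_k, (i < j)%N -> (h (s i) < h (s j))%N.
Proof.
move=> inj_h; pose t := [tuple val (h i) | i < k].
have /tuple_permP[s sE] : perm_eq (sort_tuple leq t) t by rewrite perm_sort.
exists s => i j lt_ij.
have hs a : val (h (s a)) = nth 0%N (sort leq t) a.
  have -> : sort leq t = sort_tuple leq t :> seq nat by [].
  by rewrite sE -tnth_nth !tnth_mktuple.
rewrite !hs; apply: (sorted_ltn_nth ltn_trans); rewrite ?inE ?size_sort ?size_tuple //.
have : sorted leq (sort leq t) by apply: sort_sorted leq_total _.
rewrite ltn_sorted_uniq_leq => ->; rewrite andbT sort_uniq.
by rewrite map_inj_uniq ?enum_uniq // => a b /val_inj/inj_h.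
Qed.

(** A repeated column makes the minor zero; otherwise sorting the columns gives a coordinate up to
    the sign of a permutation. *)
Lemma colsub_linear_form (h : 'I_k -> 'I_N) : exists lam : 'I_(extdim k N) -> F,
  forall W : 'M_(k, N), \sum_e lam e * (wedge W) 0 e = \det (colsub h W).
Proof.
have [inj_h|ninj] := pselect (injective h); last first.
  exists (fun=> 0) => W; rewrite big1 => [|e _]; last by rewrite mul0r.
  have [i [j [hij nij]]] : exists i j, h i = h j /\ i != j.
    apply: contrapT => H; apply: ninj => i j hij; apply/eqP/negPn/negP => nij.
    by apply: H; exists i, j.
  rewrite -det_tr; apply/esym/(determinant_alternate nij) => a.
  by rewrite !mxE hij.
have [s incr] := sort_ordfun inj_h.
have incr_ffun : [forall i : 'I_k, forall j : 'I_k, (i < j)%N ==>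
    ([ffun a => h (s a)] i < [ffun a => h (s a)] j)%N].
  by apply/forallP => i; apply/forallP => j; apply/implyP; rewrite !ffunE; apply: incr.
pose w : wedge_index k N := exist _ [ffun a => h (s a)] incr_ffun.
exists (fun e => (e == enum_rank w)%:R * (-1) ^+ s) => W.
rewrite (bigD1 (enum_rank w)) //= eqxx mul1r big1 => [|e /negPf->]; last first.
  by rewrite !mul0r.
rewrite addr0 mxE enum_rankK /=.
have -> : colsub [ffun a => h (s a)] W = col_perm s (colsub h W).
  by apply/matrixP => i j; rewrite !mxE ffunE.
by rewrite col_permE det_mulmx det_perm odd_permV mulrCA -signr_addb addbb mulr1.
Qed.

(** The Cauchy-Binet formula before equal column sets are grouped. *)
Lemma det_mul_expand (W : 'M[F]_(k, N)) (G : 'M_(N, k)) :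
  \det (W *m G) = \sum_(h : {ffun 'I_k -> 'I_N})
    (\prod_i G (h i) i) * \det (colsub h W).
Proof.
rewrite -det_tr; transitivity (\sum_(s : 'S_k) \sum_(h : {ffun 'I_k -> 'I_N})
    (-1) ^+ s * ((\prod_i W (s i) (h i)) * \prod_i G (h i) i)).
  apply: eq_bigr => s _; rewrite -mulr_sumr; congr (_ * _).
  under eq_bigr do rewrite !mxE.
  by rewrite bigA_distr_bigA; apply: eq_bigr => h _; rewrite -big_split.
rewrite exchange_big; apply: eq_bigr => h _; rewrite -det_tr mulr_sumr.
apply: eq_bigr => s _; rewrite [RHS]mulrCA; congr (_ * _); rewrite mulrC; congr (_ * _).
by apply: eq_bigr => i _; rewrite !mxE.
Qed.

(** By Cauchy-Binet the determinant of [V *m G] is linear in [wedge V], and replacing a row commutes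
    with right multiplication by [G]. Each choice of [G] thus gives a test form. *)
Lemma minor_linear_form (G : 'M[F]_(N, k)) : exists2 f : {mpoly F[extdim k N]},
  f \is 1.-homog & forall c V Phi,
    f.[! tangent_vector c V Phi] = c * \det (V *m G) + dirder (V *m G) (Phi *m G).
Proof.
have /choice[lam lamE] := fun h : {ffun 'I_k -> 'I_N} => colsub_linear_form h.
pose mu e := \sum_(h : {ffun 'I_k -> 'I_N}) (\prod_i G (h i) i) * lam h e.
have muE W : \sum_e mu e * (wedge W) 0 e = \det (W *m G).
  rewrite det_mul_expand; under eq_bigr do rewrite mulr_suml.
  rewrite exchange_big; apply: eq_bigr => h _; rewrite -lamE mulr_sumr.
  by apply: eq_bigr => e _; rewrite mulrA.
exists (\sum_e mu e *: 'X_e).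
  by apply: rpred_sum => e _; apply: dhomogZ; rewrite dhomogX /= mdeg1.
move=> c V Phi; rewrite raddf_sum /=.
transitivity (c * (\sum_e mu e * (wedge V) 0 e)
    + \sum_i \sum_e mu e * (wedge (replace_row V Phi i)) 0 e).
  rewrite exchange_big mulr_sumr -big_split; apply: eq_bigr => e _ /=.
  rewrite mevalZ mevalXU mxE [X in X + _]mxE summxE mulrDr mulrCA.
  by rewrite mulr_sumr.
rewrite muE -sum_det_replace_row; congr (_ + _); apply: eq_bigr => i _.
rewrite muE; congr (\det _); apply/matrixP => a b; rewrite !mxE.
by case: (eqVneq a i) => [->|/negPf ne]; rewrite ?mxE; apply: eq_bigr => j _;
  rewrite mxE ?eqxx ?ne.
Qed.

End LinearForms.

(** * Rank one updates and cofactors of the adjugate *)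

Section DeltaMatrices.
Variable F : fieldType.

Lemma mul_delta_mxE a b c (A : 'M[F]_(a, b)) (j : 'I_b) (i : 'I_c) x y :
  (A *m delta_mx j i) x y = A x j * (y == i)%:R.
Proof.
rewrite mxE (bigD1 j) //= !mxE eqxx /= big1 ?addr0 // => z /negPf nz.
by rewrite mxE nz mulr0.
Qed.

Lemma det1D_delta a b (A : 'M[F]_(a, b)) j i :
  \det (1%:M + A *m delta_mx j i) = 1 + A i j.
Proof.
rewrite -(mul_delta_mx (0 : 'I_1)) mulmxA det1D_comm det_mx11 mxE [X in X + _]mxE.
congr (_ + _).
by rewrite -rowE mxE mul_delta_mxE eqxx mulr1.
Qed.

(** The base point differs from the identity only in column [i], so row [i] of its adjugate is that
    of the identity. *)
Lemma dirder_delta a b (A B : 'M[F]_(a, b)) j i :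
  dirder (1%:M + A *m delta_mx j i) (B *m delta_mx j i) = B i j.
Proof.
have rowi x : \adj (1%:M + A *m delta_mx j i) i x = (i == x)%:R.
  transitivity ((\adj 1%:M : 'M[F]_a) i x); last by rewrite adj1 mxE.
  rewrite [LHS]mxE [RHS]mxE /cofactor; congr (_ * \det _); apply/matrixP => u v.
  do 2![rewrite [LHS]mxE [RHS]mxE]; rewrite mxE mul_delta_mxE eq_sym.
  by rewrite (negPf (neq_lift _ _)) mulr0 addr0.
rewrite /dirder mxtrace_mulC mulmxA /mxtrace (bigD1 i) //= mul_delta_mxE eqxx mulr1.
rewrite big1 => [|x /negPf ne]; last by rewrite mul_delta_mxE ne mulr0.
rewrite addr0 mxE (bigD1 i) //= rowi eqxx mul1r big1 ?addr0 // => x ne.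
by rewrite rowi eq_sym (negPf ne) mul0r.
Qed.

Lemma det_adj n (A : 'M[F]_n.+1) : \det A != 0 -> \det (\adj A) = \det A ^+ n.
Proof.
move=> nzA; apply: (mulfI nzA).
by rewrite -det_mulmx mul_mx_adj det_scalar exprS.
Qed.

(* Multiplying by K turns the cofactor matrix below into one whose q-th column
   is the p-th column of K and whose other columns are those of det K. *)
Lemma det_adj_replace_col n (K : 'M[F]_n.+2) p q : \det K != 0 ->
  \det (delta_mx p q + \adj K *m (1%:M - delta_mx q q)) = \det K ^+ n * K q p.
Proof.
move=> nzK; set d := \det K in nzK *; apply: (mulfI nzK).
rewrite -det_mulmx (mulmxDr K) mulmxA mul_mx_adj mul_scalar_mx -/d.
(* The first factor is the identity with column [q] replaced by column [p] of [K]; the second is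
   diagonal, with 1 in place [q] and [d] elsewhere. *)
have -> : K *m delta_mx p q + d *: (1%:M - delta_mx q q) =
    (1%:M + (K *m delta_mx p q - 1%:M) *m delta_mx q q)
    *m (d *: (1%:M + ((d^-1 - 1)%:M) *m delta_mx q q)).
  have e1 : (K *m delta_mx p q - 1%:M) *m delta_mx q q = K *m delta_mx p q - delta_mx q q.
    by rewrite mulmxBl mul1mx -mulmxA mul_delta_mx.
  have e2 : (1%:M + (K *m delta_mx p q - delta_mx q q)) *m delta_mx q q
      = K *m delta_mx p q.
    by rewrite mulmxDl mulmxBl mul1mx -mulmxA !mul_delta_mx addrC subrK.
  rewrite e1 mul_scalar_mx -scalemxAr (mulmxDr _ 1%:M) mulmx1 -scalemxAr e2.
  move: (K *m _) => L; apply/matrixP => x y; rewrite !mxE; field.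
  by [].
rewrite det_mulmx detZ !det1D_delta mxE mul_delta_mxE !mxE !eqxx !mulr1 !mulr1n.
rewrite !exprS; field.
by [].
Qed.

End DeltaMatrices.

Section AffineTangentVectors.
Variables (F : numFieldType) (k N : nat).

Lemma wedge_mul (S : 'M[F]_k) (W : 'M[F]_(k, N)) :
  wedge (S *m W) = \det S *: wedge W.
Proof.
by apply/rowP => e; rewrite [RHS]mxE !wedge_coord colsub_mul det_mulmx.
Qed.

(* The one factor outside H is moved to the last place by a transposition, whose
   sign is absorbed by that factor. *)
Lemma affine_tangent_vector c (V Phi : 'M[F]_(k, N)) : (0 < k)%N ->
  affine_tangent_space V (tangent_vector c V Phi).
Proof.
move=> k0; have zP : (k.-1 < k)%N by rewrite prednK.
pose z := Ordinal zP.
pose d (e : F) : 'rV_k := \row_a (if a == z then e else 1).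
have det_d e : \det (diag_mx (d e)) = e.
  rewrite det_diag (bigD1 z) //= mxE eqxx big1 ?mulr1 // => a /negPf ne.
  by rewrite mxE ne.
pose swap i := diag_mx (d ((-1) ^+ (i != z))) *m tperm_mx i z.
have det_swap i : \det (swap i) = 1.
  by rewrite det_mulmx det_d det_perm odd_tperm -signr_addb addbb.
(* Index 0 carries [c] times [wedge V], the others the replaced rows. *)
exists k.+1, (fun a => if unlift ord0 a is Some i then swap i *m replace_row V Phi i
                       else diag_mx (d c) *m V).
split=> [a j ltj|].
  have ne_jz : (j == z) = false by apply/eqP => jz; move: ltj; rewrite jz /= prednK ?ltnn.
  case: unliftP => [i _|_]; last first.
    suff -> : row j (diag_mx (d c) *m V) = row j V by apply: row_sub.
    by apply/rowP => b; rewrite mul_diag_mx !mxE ne_jz mul1r.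
  suff -> : row j (swap i *m replace_row V Phi i) = row (tperm i z j) V by apply: row_sub.
  apply/rowP => b; rewrite /swap -mulmxA -xrowE mul_diag_mx !mxE ne_jz mul1r.
  case: eqP => // /(canRL (tpermK i z)); rewrite tpermL => jz.
  by rewrite jz eqxx in ne_jz.
rewrite big_ord_recl unlift_none wedge_mul det_d; congr (_ + _).
by apply: eq_bigr => i _; rewrite liftK wedge_mul det_swap scale1r.
Qed.

End AffineTangentVectors.

(** * Flag vectors and the forms that detect their parameters *)

Section FlagVectors.
Variables (F : numFieldType) (l k' n' : nat).
Local Notation k := (l + k')%N.
Local Notation n := (l + n')%N.
Local Notation N := (k + n)%N.
Local Notation "f .[! t ]" := (f.@[fun i => t 0 i]) (at level 2, format "f .[! t ]").
Implicit Types (K : 'M[F]_l) (D : 'M[F]_(k', l)) (E : 'M[F]_(l, n')) (A : 'M[F]_(k, n)).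

(** The adjugate is polynomial in [K], and its minors of size [l - 1] are entries of [K] up to sign
    and a power of the determinant. *)
Definition rank_l_mx K D E : 'M[F]_(k, n) := col_mx 1%:M D *m \adj K *m row_mx 1%:M E.

(** Subtracting [rank_l_mx K D E] in [V] cancels its contribution to the coordinates of degree 1. *)
Definition flag_vector K D E A : 'rV[F]_(extdim k N) :=
  tangent_vector 1 (row_mx 1%:M (A - rank_l_mx K D E)) (row_mx 0 (rank_l_mx K D E)).

(** For an idempotent of rank [r] this is [(-1)^r (1 - r)], the factor with which minors of size [r]
    enter a flag vector at [A = 0]; it vanishes only for [r = 1]. *)
Definition idempotent_weight (P : 'M[F]_k) : F := \det (1%:M - P *+ 2) * (1 - \tr P).

Lemma idempotent_weight_neq0 (P : 'M[F]_k) : P *m P = P -> \tr P != 1 ->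
  idempotent_weight P != 0.
Proof.
move=> PP trP; apply: mulf_neq0; last by rewrite subr_eq0 eq_sym.
have : \det ((1%:M - P *+ 2) *m (1%:M - P *+ 2)) != 0.
  have -> : (1%:M - P *+ 2) *m (1%:M - P *+ 2) = 1%:M; last by rewrite det1 oner_neq0.
  rewrite mulmxBr mulmx1 mulmxBl mul1mx mulr2n mulmxDr !mulmxDl !PP.
  by apply/matrixP => x y; rewrite !mxE; ring.
by rewrite det_mulmx mulf_eq0 orbb.
Qed.

(* With V = [1 | -B] and Phi = [0 | B], column operations turn V G into Y (1 - 2P)
   and Phi G into Y P, where Y = G1 + B G2. *)
Lemma idempotent_form (G1 P : 'M[F]_k) (G2 : 'M[F]_(n, k)) :
  P *m P = P -> G1 *m P = 0 -> G2 *m P = G2 ->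
  exists2 f : {mpoly F[extdim k N]}, f \is 1.-homog & forall K D E,
    f.[! flag_vector K D E 0] = idempotent_weight P * \det (G1 + rank_l_mx K D E *m G2).
Proof.
move=> PP G1P G2P; have [f homf fE] := minor_linear_form (col_mx G1 G2).
exists f => // K D E; rewrite fE mul1r sub0r !mul_row_col mul1mx mul0mx add0r.
set B := rank_l_mx K D E; set Y := G1 + B *m G2.
have YP : Y *m P = B *m G2 by rewrite mulmxDl G1P add0r -mulmxA G2P.
have -> : G1 + - B *m G2 = Y *m (1%:M - P *+ 2).
  rewrite mulmxBr mulmx1 mulr2n mulmxDr YP /Y mulNmx.
  by apply/matrixP => x y; rewrite !mxE; ring.
rewrite -YP dirder_mul det_mulmx.
set S := 1%:M - P *+ 2.
have SS : S *m S = 1%:M.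
  rewrite mulmxBr mulmx1 mulmxBl mul1mx mulr2n mulmxDr !mulmxDl !PP.
  by apply/matrixP => x y; rewrite !mxE; ring.
have adjS : \adj S = \det S *: S.
  by rewrite -[LHS]mulmx1 -SS mulmxA mul_adj_mx mul_scalar_mx.
have PS : P *m S = - P.
  rewrite mulmxBr mulmx1 mulr2n mulmxDr PP.
  by apply/matrixP => x y; rewrite !mxE; ring.
rewrite /dirder adjS -scalemxAr PS mxtraceZ raddfN /= /idempotent_weight -/S.
by ring.
Qed.

(** The coordinate on the first [k] columns; being constant, it turns affine conditions into
    homogeneous ones. *)
Lemma unit_form : exists2 f : {mpoly F[extdim k N]}, f \is 1.-homog &
  forall K D E A, f.[! flag_vector K D E A] = 1.
Proof.
have [f homf fE] := minor_linear_form (col_mx 1%:M 0 : 'M[F]_(N, k)).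
exists f => // K D E A; rewrite fE !mul_row_col !mulmx1 !mulmx0 !addr0 det1.
by rewrite /dirder mul0mx mxtrace0 addr0 mulr1.
Qed.

Lemma affine_form i j : exists2 f : {mpoly F[extdim k N]}, f \is 1.-homog &
  forall K D E A, f.[! flag_vector K D E A] = A i j.
Proof.
have [f homf fE] := minor_linear_form (col_mx 1%:M (delta_mx j i) : 'M[F]_(N, k)).
have [g homg gE] := unit_form.
exists (f - g) => [|K D E A]; first exact: rpredB.
rewrite mevalB gE fE !mul_row_col !mulmx1 add0r det1D_delta dirder_delta.
by rewrite !mxE; ring.
Qed.

Let P0 : 'M[F]_k := block_mx 1%:M 0 0 0.
Let P0_idem : P0 *m P0 = P0.
Proof. by rewrite mulmx_block !mulmx0 !mul0mx mulmx1 !addr0. Qed.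

(** [P0] has rank [l]. With [U] and [W] zero this is a multiple of the corner minor of size [l]; a
    matrix unit for [U] or [W] brings in one entry of [D] or [E]. *)
Lemma corner_form (U : 'M[F]_(l, k')) (W : 'M[F]_(n', l)) :
  exists2 f : {mpoly F[extdim k N]}, f \is 1.-homog & forall K D E,
    f.[! flag_vector K D E 0] = idempotent_weight P0 *
      (\det (\adj K) * \det (1%:M + E *m W) * \det (1%:M - D *m U)).
Proof.
have [||f homf fE] := @idempotent_form (block_mx 0 U 0 1%:M) P0 (block_mx 1%:M 0 W 0) P0_idem.
- by rewrite mulmx_block !mulmx0 !mul0mx !addr0 block_mx0.
- by rewrite mulmx_block !mulmx0 ?mul0mx !mulmx1 !addr0.
exists f => // K D E; rewrite fE; congr (_ * _).
rewrite /rank_l_mx -mulmxA mul_row_block !mulmx0 !mul1mx addr0 -mulmxA mul_mx_row.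
rewrite mulmx0 mul_col_row !mulmx0 mul1mx add_block_mx !add0r !addr0.
set H := \adj K *m _.
have -> : block_mx H U (D *m H) 1%:M =
    block_mx 1%:M 0 D 1%:M *m block_mx H U 0 (1%:M - D *m U).
  by rewrite mulmx_block !mul1mx !mul0mx !addr0 (addrC (D *m U)) subrK.
by rewrite det_mulmx det_lblock det_ublock !det1 !mul1r det_mulmx.
Qed.


Lemma corner_weight_neq0 : l != 1%N -> idempotent_weight P0 != 0.
Proof.
move=> ne1; apply: idempotent_weight_neq0 P0_idem _.
by rewrite mxtrace_block mxtrace1 mxtrace0 addr0 pnatr_eq1.
Qed.

Lemma D_form i q : exists2 f : {mpoly F[extdim k N]}, f \is 1.-homog &
  forall K D E, f.[! flag_vector K D E 0] = idempotent_weight P0 * \det (\adj K) * D i q.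
Proof.
have [f homf fE] := corner_form 0 0; have [g homg gE] := corner_form (delta_mx q i) 0.
exists (f - g) => [|K D E]; first exact: rpredB.
rewrite mevalB fE gE -!mulNmx det1D_delta !mulmx0 !addr0 !det1 mxE.
by ring.
Qed.

Lemma E_form q j : exists2 f : {mpoly F[extdim k N]}, f \is 1.-homog &
  forall K D E, f.[! flag_vector K D E 0] = idempotent_weight P0 * \det (\adj K) * E q j.
Proof.
have [f homf fE] := corner_form 0 0; have [g homg gE] := corner_form 0 (delta_mx j q).
exists (g - f) => [|K D E]; first exact: rpredB.
by rewrite mevalB fE gE det1D_delta !mulmx0 subr0 addr0 !det1; ring.
Qed.

Lemma det_form : exists2 f : {mpoly F[extdim k N]}, f \is 1.-homog &
  forall K D E, f.[! flag_vector K D E 0] = idempotent_weight P0 * \det (\adj K).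
Proof.
have [f homf fE] := corner_form 0 0; exists f => // K D E.
by rewrite fE !mulmx0 subr0 addr0 !det1 !mulr1.
Qed.

Lemma flag_vector_in_orbit K D E A : (0 < k)%N -> \det K != 0 ->
  exists2 x, tangent_orbit F k N l x & val x = <[flag_vector K D E A]>%VS.
Proof.
move=> k0 nzK; set B := rank_l_mx K D E.
set V : 'M[F]_(k, N) := row_mx 1%:M (A - B).
set Phi : 'M[F]_(k, N) := row_mx 0 B.
have [f homf f1] := unit_form.
have nz_t : flag_vector K D E A != 0.
  apply/eqP => t0; have := f1 K D E A; rewrite t0 -(scale0r (0 : 'rV[F]__)).
  by rewrite (meval_homog _ _ homf) expr1 mul0r => /esym/eqP; rewrite oner_eq0.
have [x xE] := projective_pointP nz_t; exists x => //.
have freeV : row_free V.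
  by apply/row_freeP; exists (col_mx 1%:M 0); rewrite mul_row_col mulmx0 addr0 mulmx1.
have nz_V : wedge V != 0.
  (* Were [wedge V] zero, raising [c] from 0 to 1 would not alter the vector, yet the test form
     grows by 1. *)
  apply/eqP => wV0; have [g _ gE] := minor_linear_form (col_mx 1%:M 0 : 'M[F]_(N, k)).
  have e0 := gE 0 V Phi; have := gE 1 V Phi.
  rewrite /tangent_vector wV0 !scaler0 in e0 *; rewrite e0 mul0r mul1r => /addIr.
  by rewrite mul_row_col mulmx0 addr0 mulmx1 det1 => /esym/eqP; rewrite oner_eq0.
have [p pE] := projective_pointP nz_V.
exists p, V, (flag_vector K D E A), Phi; split; split => //.
- by exists V.
- exact: affine_tangent_vector.
- by exists 1.
(* At most [l] by the factorisation of [Phi]; at least [l] because [\adj K] is a block of [B] and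
   [B] loses no rank modulo [V]. *)
rewrite /hom_rank; apply/eqP; rewrite eqn_leq; apply/andP; split.
  have -> : Phi = (col_mx 1%:M D *m \adj K) *m row_mx 0 (row_mx 1%:M E).
    by rewrite mul_mx_row mulmx0.
  by rewrite -!mulmxA (leq_trans (mxrankM_maxr _ _)) // (leq_trans (mxrankM_maxl _ _))
    ?rank_leq_row.
have uadj : \adj K \in unitmx.
  have /mulmx1_unit[] // : \adj K *m ((\det K)^-1 *: K) = 1%:M.
  by rewrite -scalemxAr mul_adj_mx scale_scalar_mx mulVf.
apply: (@leq_trans (\rank B)).
  have adjE : \adj K = row_mx 1%:M 0 *m B *m col_mx 1%:M 0.
    rewrite /B /rank_l_mx !mulmxA mul_row_col mul0mx addr0 !mul1mx.
    by rewrite -mulmxA mul_row_col mulmx0 addr0 !mulmx1.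
  rewrite -{1}(mxrank_unit uadj) adjE.
  by rewrite (leq_trans (mxrankM_maxl _ _)) // mxrankM_maxr.
(* This matrix kills [V] and recovers [B] from [Phi], so whatever kills [Phi] modulo [V] kills
   [B]. *)
have PhiC : Phi *m col_mx (B - A) 1%:M = B by rewrite mul_row_col mul0mx add0r mulmx1.
have VC : V *m col_mx (B - A) 1%:M = 0.
  by rewrite mul_row_col mul1mx mulmx1 -opprB addNr.
have sker : (kermx (Phi *m cokermx V) <= kermx B)%MS.
  apply/sub_kermxP; rewrite -PhiC mulmxA.
  have /submxP[Z ->] : (kermx (Phi *m cokermx V) *m Phi <= V)%MS.
    by rewrite submxE -mulmxA mulmx_ker.
  by rewrite -mulmxA VC mulmx0.
by have := mxrankS sker; rewrite !mxrank_ker leq_sub2lE ?rank_leq_row.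
Qed.

End FlagVectors.

Section CofactorForm.
Variables (F : numFieldType) (l' k' n' : nat).
Local Notation l := l'.+2.
Local Notation k := (l + k')%N.
Local Notation n := (l + n')%N.
Local Notation N := (k + n)%N.
Local Notation "f .[! t ]" := (f.@[fun i => t 0 i]) (at level 2, format "f .[! t ]").

(** The idempotent has rank [l - 1], so its weight vanishes only when [l' = 0]. The minor is a
    cofactor of [\adj K], given by [det_adj_replace_col]. *)
Lemma cofactor_form (q p : 'I_l) : exists2 f : {mpoly F[extdim k N]}, f \is 1.-homog &
  exists2 w, (l' != 0%N -> w != 0) &
  forall K (D : 'M_(k', l)) (E : 'M_(l, n')), \det K != 0 ->
    f.[! flag_vector K D E 0] = w * (\det K ^+ l' * K q p).
Proof.
pose Q : 'M[F]_l := 1%:M - delta_mx q q.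
have QQ : Q *m Q = Q.
  by rewrite mulmxBr mulmx1 mulmxBl mul1mx mul_delta_mx subrr subr0.
have dQ : delta_mx p q *m Q = 0 by rewrite mulmxBr mulmx1 mul_delta_mx subrr.
pose P : 'M[F]_k := block_mx Q 0 0 0.
have PP : P *m P = P by rewrite mulmx_block !mulmx0 !mul0mx QQ !addr0.
have [||f homf fE] := @idempotent_form F l k' n' (block_mx (delta_mx p q) 0 0 1%:M) P
    (block_mx Q 0 0 0) PP.
- by rewrite mulmx_block !mulmx0 !mul0mx dQ !addr0 block_mx0.
- by rewrite mulmx_block !mulmx0 !mul0mx QQ !addr0.
exists f => //; exists (idempotent_weight P) => [nz_l'|K D E nzK].
  apply: idempotent_weight_neq0 => //.
  have trd : \tr (delta_mx q q : 'M[F]_l) = 1.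
    rewrite /mxtrace (bigD1 q) //= mxE !eqxx big1 ?addr0 // => x /negPf ne.
    by rewrite mxE ne.
  rewrite mxtrace_block mxtrace0 addr0 raddfB /= mxtrace1 trd.
  by rewrite mulrS addrAC subrr add0r -subr_eq0 mulrS addrAC subrr add0r pnatr_eq0.
rewrite fE; congr (_ * _).
rewrite /rank_l_mx -mulmxA mul_row_block !mulmx0 !mul1mx !addr0 -mulmxA mul_mx_row.
rewrite !mulmx0 mul_col_row !mulmx0 mul1mx add_block_mx !add0r !addr0.
by rewrite det_lblock det1 mulr1 det_adj_replace_col.
Qed.

End CofactorForm.

Section LowerBound.
Variables (F : numFieldType) (l' k' n' : nat).
Local Notation l := l'.+2.
Local Notation k := (l + k')%N.
Local Notation n := (l + n')%N.
Local Notation N := (k + n)%N.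
Local Notation "f .[! t ]" := (f.@[fun i => t 0 i]) (at level 2, format "f .[! t ]").

(** The parametrisation of [K] is left open, to serve both [l >= 3], with all entries free, and
    [l = 2], with a single parameter. *)
Variables (JK : finType) (Kof : (JK -> F) -> 'M[F]_l) (base : JK -> F).
Hypotheses (polyfun_K : polyfun_mx (@coordinate F JK) Kof) (K_base : Kof base = 1%:M).
Hypothesis K_detected : forall j, exists2 f : {mpoly F[extdim k N]},
  (exists d, f \is d.-homog) &
  (forall p (D : 'M_(k', l)) (E : 'M_(l, n')), \det (Kof p) != 0 -> p j = base j ->
     f.[! flag_vector (Kof p) D E 0] = 0) /\
  exists p, [/\ forall j', j' != j -> p j' = base j', \det (Kof p) != 0 &
    f.[! flag_vector (Kof p) (0 : 'M_(k', l)) (0 : 'M_(l, n')) 0] != 0].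

Lemma orbit_flag_chain : exists Z, irreducible_chain (tangent_orbit F k N l)
  (#|JK| + (k' * l + l * n') + k * n) Z.
Proof.
pose J := (JK + ('I_k' * 'I_l + 'I_l * 'I_n') + 'I_k * 'I_n)%type.
have <- : #|{: J}| = (#|JK| + (k' * l + l * n') + k * n)%N.
  by rewrite !card_sum !card_prod !card_ord.
pose Kp (p : J -> F) := Kof (fun j => p (inl (inl j))).
pose D (p : J -> F) := mxcoord (fun x : 'I_k' * 'I_l => inl (inr (inl x))) p.
pose E (p : J -> F) := mxcoord (fun x : 'I_l * 'I_n' => inl (inr (inr x))) p.
pose A (p : J -> F) := mxcoord (fun x : 'I_k * 'I_n => inr x) p.
pose phi p := flag_vector (Kp p) (D p) (E p) (A p).
pose chi p := \det (Kp p).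
pose a0 (j : J) : F := if j is inl (inl j') then base j' else 0.
(* The entries of [A] are freed last, as the forms for the other parameters are evaluated at
   [A = 0]. *)
pose stage (j : J) := if j is inr _ then 1%N else 0%N.
have pfK : polyfun_mx (@coordinate F J) Kp.
  move=> i j; apply: (polyfun_comp _ (polyfun_K i j)) => _ [a ->].
  by apply: polyfun_gen; exists (inl (inl a)).
have pfB : polyfun_mx (@coordinate F J) (fun p => rank_l_mx (Kp p) (D p) (E p)).
  apply: polyfun_mx_mul; first apply: polyfun_mx_mul.
  - by apply: polyfun_mx_col; [exact: polyfun_mx_const | exact: polyfun_mxcoord].
  - exact: polyfun_adj.
  - by apply: polyfun_mx_row; [exact: polyfun_mx_const | exact: polyfun_mxcoord].
have pfphi i : polyfun (@coordinate F J) (fun p => phi p 0 i).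
  apply: polyfun_tangent_vector; first exact: polyfun_const.
    apply: polyfun_mx_row; first exact: polyfun_mx_const.
    apply: polyfun_mx_add; [exact: polyfun_mxcoord | exact: polyfun_mx_opp].
  by apply: polyfun_mx_row; first exact: polyfun_mx_const.
have pfchi : polyfun (@coordinate F J) chi by apply: polyfun_det.
have Kp_base p : (forall j, p (inl (inl j)) = base j) -> Kp p = 1%:M.
  by move=> pb; rewrite /Kp (_ : (fun j => _) = base) //; apply/funext.
pose detects j f := [/\ exists d, f \is d.-homog,
  forall p, chi p != 0 -> p j = a0 j ->
    (forall j', (stage j < stage j')%N -> p j' = a0 j') -> f.[! phi p] = 0 &
  exists b, [/\ chi b != 0, forall j', j' != j -> b j' = a0 j' & f.[! phi b] != 0]].
pose bump j0 (j : J) : F := if j == j0 then 1 else a0 j.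
have bumpE j0 j : j != j0 -> bump j0 j = a0 j by rewrite /bump => /negPf ->.
have A0 p : (forall j', (0 < stage j')%N -> p j' = a0 j') -> A p = 0.
  by move=> pa; apply: mxcoordE => i j; rewrite mxE pa.
have adj1K : \det (\adj (1%:M : 'M[F]_l)) = 1 by rewrite adj1 det1.
have /choice[f fP] : forall j, exists f, detects j f.
  case=> [[j0|[[i q]|[q j]]]|[i j]].
  - have [f homf [fv [p [pb nzp fp]]]] := K_detected j0.
    exists f; split => // [p' chip' pj0 /A0 Ap'|].
      by rewrite /phi Ap'; apply: fv.
    pose b (j : J) : F := if j is inl (inl j') then p j' else 0.
    exists b; split; first exact: nzp.
      case=> [[j'|x]|x] ne; [|by []|by []].
      by apply: pb; apply: contraNneq ne => ->.
    rewrite /phi; have -> : A b = 0 by apply: mxcoordE => i j; rewrite mxE.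
    have -> : D b = 0 by apply: mxcoordE => i j; rewrite mxE.
    by have -> : E b = 0 by apply: mxcoordE => i j; rewrite mxE.
  - have [f homf fE] := @D_form F l k' n' i q.
    exists f; split; first by exists 1%N.
      by move=> p _ pj /A0 Ap; rewrite /phi Ap fE mxE pj mulr0.
    set j0 : J := inl _; have Kb : Kp (bump j0) = 1%:M by apply: Kp_base => j; rewrite bumpE.
    exists (bump j0); split; [by rewrite /chi Kb det1 oner_eq0 | exact: bumpE |].
    have Ab : A (bump j0) = 0 by apply: A0 => -[|].
    by rewrite /phi Ab fE Kb adj1K mxE /bump eqxx !mulr1 corner_weight_neq0.
  - have [f homf fE] := @E_form F l k' n' q j.
    exists f; split; first by exists 1%N.
      by move=> p _ pj /A0 Ap; rewrite /phi Ap fE mxE pj mulr0.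
    set j0 : J := inl _; have Kb : Kp (bump j0) = 1%:M by apply: Kp_base => j'; rewrite bumpE.
    exists (bump j0); split; [by rewrite /chi Kb det1 oner_eq0 | exact: bumpE |].
    have Ab : A (bump j0) = 0 by apply: A0 => -[|].
    by rewrite /phi Ab fE Kb adj1K mxE /bump eqxx !mulr1 corner_weight_neq0.
  - have [f homf fE] := @affine_form F l k' n' i j.
    exists f; split; first by exists 1%N.
      by move=> p _ pj _; rewrite fE mxE pj.
    set j0 : J := inr _; have Kb : Kp (bump j0) = 1%:M by apply: Kp_base => j'; rewrite bumpE.
    exists (bump j0); split; [by rewrite /chi Kb det1 oner_eq0 | exact: bumpE |].
    by rewrite fE mxE /bump eqxx oner_eq0.
apply: (@flag_chain F _ J _ phi pfphi stage chi a0 f pfchi).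
- by rewrite /chi Kp_base // det1 oner_eq0.
- by move=> p chip; apply: flag_vector_in_orbit.
- by move=> j; case: (fP j).
- by move=> j; case: (fP j).
- by move=> j; case: (fP j).
Qed.

End LowerBound.

Section Flags.
Variables (F : numFieldType) (k' n' : nat).
Local Notation "f .[! t ]" := (f.@[fun i => t 0 i]) (at level 2, format "f .[! t ]").

Lemma tangent_orbit_flag l' : (0 < l')%N -> let l := l'.+2 in
  exists Z, irreducible_chain (tangent_orbit F (l + k') (l + k' + (l + n')) l)
    (l * l + (k' * l + l * n') + (l + k') * (l + n')) Z.
Proof.
move=> l'_gt0 l; pose JK := ('I_l * 'I_l)%type.
have <- : #|{: JK}| = (l * l)%N by rewrite card_prod !card_ord.
pose base (x : JK) : F := (x.1 == x.2)%:R.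
have K_base : mxcoord id base = 1%:M by apply/matrixP => i j; rewrite !mxE.
apply: (@orbit_flag_chain F l' k' n' JK _ base (@polyfun_mxcoord F JK l l id) K_base) => -[q p].
have [f homf [w /(_ (lt0n_neq0 l'_gt0)) nz_w fE]] := @cofactor_form F l' k' n' q p.
have [g homg gE] := @det_form F l k' n'.
have [h homh hE] := @unit_form F l k' n'.
set v := idempotent_weight _ in gE.
have nz_v : v != 0 by apply: corner_weight_neq0.
(* The value of f is w d^l' K_qp and that of g is v d^(l'+1), where d = det K. *)
pose tau : F := (q == p)%:R.
(* The exponents give both terms the same power of [d], so [F0] compares [K q p ^+ l'.+1] with
   [tau]; the factor [h] equalises the degrees. *)
pose F0 := v ^+ l' *: f ^+ l'.+1 - (tau * w ^+ l'.+1) *: (g ^+ l' * h).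
have F0E K (D : 'M_(k', l)) (E : 'M_(l, n')) : \det K != 0 ->
    F0.[! flag_vector K D E 0] = v ^+ l' * w ^+ l'.+1 * \det K ^+ (l' * l'.+1)
      * (K q p ^+ l'.+1 - tau).
  move=> nzK; rewrite mevalB !mevalZ mevalM !rmorphXn /= fE // gE hE det_adj //.
  by rewrite !exprMn -!exprM (mulnC l'.+1); ring.
exists F0.
  have homogX (e : {mpoly F[_]}) i : e \is 1.-homog -> e ^+ i \is i.-homog.
    by move=> /(dhomogMn i); rewrite mul1n.
  exists l'.+1; apply: rpredB; apply: dhomogZ; first exact: homogX.
  by have := dhomogM (homogX _ _ l' homg) homh; rewrite addn1.
split=> [a D E nzK ab|].
  rewrite F0E // mxE ab /base /= -/tau.
  by rewrite /tau; case: (q == p); rewrite ?expr1n ?expr0n subrr mulr0.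
(* Adding 1 to one entry of the identity gives determinant 1 or 2, and an entry 1 against [tau = 0]
   or 2 against [tau = 1]. *)
pose b (x : JK) : F := base x + (x == (q, p))%:R.
have KbE : mxcoord id b = 1%:M + 1%:M *m delta_mx q p.
  by rewrite mul1mx; apply/matrixP => i j; rewrite !mxE.
have det_b : \det (mxcoord id b) = 1 + tau by rewrite KbE det1D_delta mxE eq_sym.
have nz_det : \det (mxcoord id b) != 0.
  by rewrite det_b /tau; case: (q == p); rewrite ?addr0 ?oner_eq0 // -[1 + _]/(2%:R) pnatr_eq0.
exists b; split => // [x ne|]; first by rewrite /b (negPf ne) addr0.
rewrite F0E // !mulf_neq0 ?expf_neq0 // mxE /b /base /= eqxx -/tau.
rewrite /tau; case: (q == p); last by rewrite add0r expr1n subr0 oner_eq0.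
rewrite -[true%:R + _]/(2%:R) subr_eq0 -natrX -[true%:R]/(1%:R) eqr_nat.
by rewrite -(expn0 2) eqn_exp2l.
Qed.

(** Minors of size [l - 1 = 1] have weight 0, so [K] keeps one parameter, detected through its
    determinant. *)
Lemma tangent_orbit2_flag :
  exists Z, irreducible_chain (tangent_orbit F (2 + k') (2 + k' + (2 + n')) 2)
    (1 + (k' * 2 + 2 * n') + (2 + k') * (2 + n')) Z.
Proof.
pose Kof (a : unit -> F) : 'M[F]_2 := 1%:M + (a tt)%:M *m delta_mx 0 0.
have detK a : \det (Kof a) = 1 + a tt by rewrite det1D_delta mxE eqxx.
have := @orbit_flag_chain F 0 k' n' unit Kof (fun=> 0); rewrite card_unit; apply.
- apply: polyfun_mx_add; first exact: polyfun_mx_const.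
  apply: polyfun_mx_mul; last exact: polyfun_mx_const.
  move=> i j; apply: (@polyfun_ext _ _ _ (fun a : unit -> F => a tt * (i == j)%:R)).
    by move=> a; rewrite mxE mulr_natr.
  by apply: polyfun_mul; [apply: polyfun_gen; exists tt | exact: polyfun_const].
- by rewrite /Kof raddf0 mul0mx addr0.
case; have [g homg gE] := @det_form F 2 k' n'; have [h homh hE] := @unit_form F 2 k' n'.
set v := idempotent_weight _ in gE.
have nz_v : v != 0 by apply: corner_weight_neq0.
have fE a (D : 'M_(k', 2)) (E : 'M_(2, n')) : \det (Kof a) != 0 ->
    (g - v *: h).[! flag_vector (Kof a) D E 0] = v * a tt.
  by move=> nzK; rewrite mevalB mevalZ gE hE det_adj // detK expr1; ring.
exists (g - v *: h); first by exists 1%N; apply: rpredB => //; apply: dhomogZ.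
split=> [a D E nzK a0|]; first by rewrite fE // a0 mulr0.
exists (fun=> 1); have nzK : \det (Kof (fun=> 1)) != 0.
  by rewrite detK -[1 + 1]/(2%:R) pnatr_eq0.
by split; [case | exact: nzK | rewrite fE // mulr1].
Qed.

End Flags.

Theorem proposition5p1p1 (R : realType) (k N l : nat)
    (hk : (3 <= k)%N) (hkN : (2 * k <= N)%N)
    (hl2 : (2 <= l)%N) (hlk : (l <= k)%N) :
  has_dimension (tangent_orbit (complex R) k N l)
    (if l == 2 then k * (N - k) + 2 * (N - 2) - 3
     else k * (N - k) + l * (N - l))%N.
Proof.
(* Both complements exist because [l <= k <= N - k]. *)
have [k' kE] : exists k', k = (l + k')%N by exists (k - l)%N; lia.
have [n' NE] : exists n', N = (k + (l + n'))%N by exists (N - k - l)%N; lia.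
subst k N; case: eqP => [l2|l_neq2].
  subst l; have -> : ((2 + k') * (2 + k' + (2 + n') - (2 + k'))
      + 2 * (2 + k' + (2 + n') - 2) - 3
      = 1 + (k' * 2 + 2 * n') + (2 + k') * (2 + n'))%N by rewrite addKn; lia.
  split; first exact: tangent_orbit2_flag.
  by move=> e Z /tangent_orbit2_chain_le; lia.
have [l' lE] : exists l', l = l'.+2 by exists (l - 2)%N; lia.
subst l; have -> : ((l'.+2 + k') * (l'.+2 + k' + (l'.+2 + n') - (l'.+2 + k'))
      + l'.+2 * (l'.+2 + k' + (l'.+2 + n') - l'.+2)
      = l'.+2 * l'.+2 + (k' * l'.+2 + l'.+2 * n') + (l'.+2 + k') * (l'.+2 + n'))%N.
  by rewrite addKn -[X in (X - l'.+2)%N]addnA addKn; lia.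
split; first by apply: tangent_orbit_flag; lia.
by move=> e Z /tangent_orbit_chain_le; lia.
Qed.
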